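(* Let $\gamma>\gamma_0\ge 0$ and $\eta=1-\gamma^{-2}$. Consider the quadratic system $\dot{\mathbf x}=\mathbf A\mathbf x+\mathbf F(\mathbf x\otimes\mathbf x)+\mathbf B\mathbf u$, $\mathbf y=\mathbf C\mathbf x$, with $\mathbf A\in\mathbb R^{n\times n}$, $\mathbf F\in\mathbb R^{n\times n^2}$, $\mathbf B\in\mathbb R^{n\times m}$, $\mathbf C\in\mathbb R^{p\times n}$. Let its $\mathcal H_\infty$ past energy function $\mathcal E_\gamma^-$ be expanded around the origin, up to degree $d\ge 2$, as $$\mathcal E_\gamma^-(\mathbf x)\approx\tfrac12\left(\mathbf v_2^\top\mathbf x^{\otimes 2}+\mathbf v_3^\top\mathbf x^{\otimes 3}+\dots+\mathbf v_d^\top\mathbf x^{\otimes d}\right),$$ with symmetric coefficient vectors $\mathbf v_k\in\mathbb R^{n^k}$ (i.e. the right-hand side is the degree-$d$ Taylor polynomial of $\mathcal E_\gamma^-$ at $\mathbf 0$). Then: (1) $\mathbf v_2=\mathrm{vec}(\mathbf V_2)$, where $\mathbf V_2$ is the symmetric positive definite solution (the one for which $\mathbf V_2^{-1}=\mathbf Y_\infty$ is stabilizing) of the $\mathcal H_\infty$ Riccati equation $$\mathbf 0=\mathbf A^\top\mathbf V_2+\mathbf V_2\mathbf A-\eta\,\mathbf C^\top\mathbf C+\mathbf V_2\mathbf B\mathbf B^\top\mathbf V_2 .$$ (2) For $2<k\le d$, let $\widetilde{\mathbf v}_k\in\mathbb R^{n^k}$ solve the linear system $$\mathcal L_k\big((\mathbf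 A+\mathbf B\mathbf B^\top\mathbf V_2)^\top\big)\widetilde{\mathbf v}_k=-\mathcal L_{k-1}(\mathbf F^\top)\mathbf v_{k-1}-\frac14\sum_{\substack{i,j>2\\ i+j=k+2}} ij\;\mathrm{vec}(\mathbf V_i^\top\mathbf B\mathbf B^\top\mathbf V_j).$$ Then the coefficient vector $\mathbf v_k=\mathrm{vec}(\mathbf V_k)\in\mathbb R^{n^k}$ is the symmetrization of $\widetilde{\mathbf v}_k$.
   Context: Notation. $\mathbf x^{\otimes k}=\mathbf x\otimes\cdots\otimes\mathbf x\in\mathbb R^{n^k}$ ($k$ factors, Kronecker product). $\mathrm{vec}$ stacks columns. For $k\ge 2$, $\mathbf V_k\in\mathbb R^{n\times n^{k-1}}$ is the matrix with $\mathrm{vec}(\mathbf V_k)=\mathbf v_k$. For $\mathbf M\in\mathbb R^{q\times n}$, the $k$-way Lyapunov matrix is $$\mathcal L_k(\mathbf M)=\mathbf M\otimes\mathbf I_n\otimes\cdots\otimes\mathbf I_n+\mathbf I_n\otimes\mathbf M\otimes\cdots\otimes\mathbf I_n+\cdots+\mathbf I_n\otimes\cdots\otimes\mathbf I_n\otimes\mathbf M\in\mathbb R^{n^{k-1}q\times n^k}$$ ($k$ summands, each with $k$ factors, exactly one of which is $\mathbf M$). Symmetry. $\mathbf v_d\in\mathbb R^{n^d}$ is symmetric if $\mathbf v_d^\top(\mathbf a_1\otimes\cdots\otimes\mathbf a_d)=\mathbf v_d^\top(\mathbf a_{i_1}\otimes\cdots\otimes\mathbf a_{i_d})$ for all $\mathbf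 a_1,\dots,\mathbf a_d\in\mathbb R^n$ and every permutation $(i_1,\dots,i_d)$ of $(1,\dots,d)$. The symmetrization of $\widetilde{\mathbf v}\in\mathbb R^{n^d}$ is the unique symmetric $\mathbf v$ with $\mathbf v^\top\mathbf x^{\otimes d}=\widetilde{\mathbf v}^\top\mathbf x^{\otimes d}$ for all $\mathbf x$ (average over all index permutations). Each row of $\mathbf F$ is assumed symmetric. Constant $\gamma_0$. $\gamma_0$ is the smallest $\tilde\gamma$ such that a stabilizing controller exists for which the $\mathcal H_\infty$ norm of the closed-loop system is less than $\tilde\gamma$, for the LTI system $(\mathbf A,\mathbf B,\mathbf C)$ (standard normalized $\mathcal H_\infty$ problem: $\dot{\mathbf x}=\mathbf A\mathbf x+\mathbf B\mathbf w_{(1)}+\mathbf B\mathbf u$, measured output $\mathbf C\mathbf x+\mathbf w_{(2)}$, performance output $(\mathbf C\mathbf x,\mathbf u)$, closed loop from the disturbances $(\mathbf w_{(1)},\mathbf w_{(2)})$ to the performance output). The known fact underlying the assumption $\gamma>\gamma_0$ is that then the Riccati equations $$\mathbf A\mathbf Y_\infty+\mathbf Y_\infty\mathbf A^\top+\mathbf B\mathbf B^\top-\eta\mathbf Y_\infty\mathbf C^\top\mathbf C\mathbf Y_\infty=\mathbf 0,\qquad \mathbf A^\top\mathbf X_\infty+\mathbf X_\infty\mathbf A+\mathbf C^\top\mathbf C-\eta\mathbf X_\infty\mathbf B\mathbf B^\top\mathbf X_\infty=\mathbf 0$$ have symmetric positive definite stabilizing solutions, i.e. $\mathbf A-\eta\mathbf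 Y_\infty\mathbf C^\top\mathbf C$ and $\mathbf A-\eta\mathbf B\mathbf B^\top\mathbf X_\infty$ have all eigenvalues in the open left half-plane. This may be taken as a hypothesis. Past energy function. $\mathcal E_\gamma^-(\mathbf x_0)$ is the minimum over $\mathbf u\in L_2(-\infty,0]$ with $\mathbf x(-\infty)=\mathbf 0$, $\mathbf x(0)=\mathbf x_0$ of $\frac12\int_{-\infty}^0(1-\gamma^{-2})\|\mathbf y(t)\|^2+\|\mathbf u(t)\|^2\,dt$. It is assumed to exist and be smooth (analytic) near the origin, and it is characterized, in a neighborhood of the origin, as the solution with $\mathcal E_\gamma^-(\mathbf 0)=0$ of the Hamilton–Jacobi–Bellman equation $$0=\frac{\partial\mathcal E_\gamma^-(\mathbf x)}{\partial\mathbf x}\left[\mathbf A\mathbf x+\mathbf F(\mathbf x\otimes\mathbf x)\right]+\frac12\frac{\partial\mathcal E_\gamma^-(\mathbf x)}{\partial\mathbf x}\mathbf B\mathbf B^\top\frac{\partial^\top\mathcal E_\gamma^-(\mathbf x)}{\partial\mathbf x}-\frac{\eta}{2}\mathbf x^\top\mathbf C^\top\mathbf C\mathbf x$$ for which the vector field $-\left(\mathbf A\mathbf x+\mathbf F(\mathbf x\otimes\mathbf x)+\mathbf B\mathbf B^\top\frac{\partial^\top\mathcal E_\gamma^-(\mathbf x)}{\partial\mathbf x}\right)$ is asymptotically stable at the origin. Here $\frac{\partial\mathcal E}{\partial\mathbf x}$ is a row vector. *)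

(* Defs.v *)
From HB Require Import structures.
From mathcomp Require Import all_boot all_order all_algebra all_fingroup.
From mathcomp Require Import all_classical all_reals all_analysis.
From mathcomp Require Import complex mxtens.

Set Implicit Arguments.
Unset Strict Implicit.
Unset Printing Implicit Defensive.

Import Order.TTheory GRing.Theory Num.Theory.
Import numFieldNormedType.Exports.

Local Open Scope classical_set_scope.
Local Open Scope ring_scope.

(* Transport along an equality of dimensions that holds propositionally but not
   by conversion (e.g. n * n ^ k = n ^ k.+1).  It is total: it is [castmx] when
   the dimensions agree and 0 otherwise.  The dimensions agree in every use
   below and in the range of indices where the formulas are meaningful; see
   [kron_dim], [lyap_dim_row], [lyap_dim_col], [lyap_dim_sq], [lyap_dim_quad],
   [vec_dim] and [vec_mul_dim]. *)
Definition recast (T : nmodType) (m1 n1 m2 n2 : nat) (M : 'M[T]_(m1, n1)) :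
  'M[T]_(m2, n2) := conform_mx 0 M.

Lemma recastE (T : nmodType) m1 n1 m2 n2 (e : (m1 = m2) * (n1 = n2))
  (M : 'M[T]_(m1, n1)) : recast m2 n2 M = castmx e M.
Proof.
case: e => e1 e2; case: m2 / e1; case: n2 / e2.
by rewrite /recast conform_mx_id castmx_id.
Qed.

Arguments recast {T m1 n1 m2 n2} M.

Fact kron_dim n k : (n * n ^ k = n ^ k.+1)%N.
Proof. by rewrite expnS. Qed.

Fact lyap_dim_row n q k i : (i < k)%N ->
  (n ^ i * (q * n ^ (k - i.+1)) = n ^ k.-1 * q)%N.
Proof.
case: k => // k; rewrite ltnS subSS /= => ik.
by rewrite mulnCA -expnD subnKC // mulnC.
Qed.

Fact lyap_dim_col n k i : (i < k)%N ->
  (n ^ i * (n * n ^ (k - i.+1)) = n ^ k)%N.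
Proof. by move=> ik; rewrite -expnS subnSK // -expnD subnKC // ltnW. Qed.

Fact lyap_dim_sq n k : (0 < k)%N -> (n ^ k.-1 * n = n ^ k)%N.
Proof. by case: k => // k _; rewrite /= mulnC -expnS. Qed.

Fact lyap_dim_quad n k : (2 < k)%N -> (n ^ k.-1.-1 * n ^ 2 = n ^ k)%N.
Proof. by case: k => [|[|k]] // _; rewrite /= -expnD addn2. Qed.

Fact vec_dim n k : (2 <= k)%N -> (n ^ k.-1 * n = n ^ k)%N.
Proof. by move=> k2; apply: lyap_dim_sq; apply: leq_trans k2. Qed.

Fact vec_mul_dim n k i j : (2 < i)%N -> (2 < j)%N -> (i + j = k + 2)%N ->
  (n ^ j.-1 * n ^ i.-1 = n ^ k)%N.
Proof.
case: i => // i; case: j => // j _ _ /eqP.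
rewrite addnS addSn addn2 !eqSS => /eqP <-.
by rewrite /= -expnD addnC.
Qed.

Fixpoint kron (T : pzRingType) (n k : nat) : ('I_k -> 'cV[T]_n) -> 'cV[T]_(n ^ k) :=
  match k with
  | 0 => fun _ => const_mx 1
  | k'.+1 => fun a =>
      recast (tensmx (a ord0) (kron (fun i : 'I_k' => a (lift ord0 i))))
  end.

Definition kpow (T : pzRingType) (n : nat) (x : 'cV[T]_n) (k : nat) : 'cV[T]_(n ^ k) :=
  kron (fun _ : 'I_k => x).

(* Stacks columns: entry M i j is sent to position j * m + i. *)
Definition vec (T : Type) (m n : nat) (M : 'M[T]_(m, n)) : 'cV[T]_(n * m) :=
  \col_l M (mxtens_unindex l).2 (mxtens_unindex l).1.

(* The i-th summand has M in position i; the identity factors on either side of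
   it are grouped as I_{n^i} and I_{n^(k-1-i)}. *)
Definition lyap (T : pzRingType) (n q k : nat) (M : 'M[T]_(q, n)) :
    'M[T]_(n ^ k.-1 * q, n ^ k) :=
  \sum_(i < k) recast (tensmx (1%:M : 'M[T]_(n ^ i))
                        (tensmx M (1%:M : 'M[T]_(n ^ (k - i.+1))))).

Definition sym_tensor (T : pzRingType) (n k : nat) (v : 'cV[T]_(n ^ k)) : Prop :=
  forall (a : 'I_k -> 'cV[T]_n) (s : 'S_k),
    v^T *m kron a = v^T *m kron (fun i => a (s i)).

Definition symmetrization_of (T : pzRingType) (n k : nat) (w v : 'cV[T]_(n ^ k)) : Prop :=
  sym_tensor v /\ forall x : 'cV[T]_n, v^T *m kpow x k = w^T *m kpow x k.

Definition sqnorm (R : realType) (n : nat) (x : 'cV[R]_n) : R :=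
  \sum_i x i 0 ^+ 2.

Definition posdef (R : realType) (n : nat) (M : 'M[R]_n) : Prop :=
  M^T = M /\ forall x : 'cV[R]_n, x != 0 -> 0 < (x^T *m M *m x) 0 0.

Definition toC (R : realType) (m n : nat) (M : 'M[R]_(m, n)) : 'M[R[i]]_(m, n) :=
  map_mx (real_complex R) M.

Definition hurwitz (R : realType) (n : nat) (M : 'M[R]_n) : Prop :=
  forall z : R[i], eigenvalue (toC M) z -> complex.Re z < 0.

Definition transfer (R : realType) (n m p : nat) (A : 'M[R]_n) (B : 'M[R]_(n, m))
    (C : 'M[R]_(p, n)) (D : 'M[R]_(p, m)) (s : R[i]) : 'M[R[i]]_(p, m) :=
  toC C *m invmx (s%:M - toC A) *m toC B + toC D.

Definition cnorm (R : realType) (n : nat) (w : 'cV[R[i]]_n) : R :=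
  Num.sqrt (\sum_i (complex.Re (w i 0) ^+ 2 + complex.Im (w i 0) ^+ 2)).

(* sup over real frequencies of the largest singular value of the transfer
   matrix (for a Hurwitz state matrix). *)
Definition hinf_norm (R : realType) (n m p : nat) (A : 'M[R]_n) (B : 'M[R]_(n, m))
    (C : 'M[R]_(p, n)) (D : 'M[R]_(p, m)) : \bar R :=
  ereal_sup [set r | exists (omega : R) (w : 'cV[R[i]]_m), cnorm w <= 1 /\
    r = (cnorm (transfer A B C D (Complex 0 omega) *m w))%:E].

(* Plant:       x' = A x + B w1 + B u,   measurement C x + w2,
   controller:  xi' = K xi + L (C x + w2),   u = M xi + N (C x + w2).
   Closed loop from (w1, w2) to (C x, u), with state (x, xi): *)
Definition cl_state (R : realType) n m p r (A : 'M[R]_n) (B : 'M[R]_(n, m))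
    (C : 'M[R]_(p, n)) (K : 'M[R]_r) (L : 'M[R]_(r, p)) (M : 'M[R]_(m, r))
    (N : 'M[R]_(m, p)) : 'M[R]_(n + r) :=
  block_mx (A + B *m N *m C) (B *m M) (L *m C) K.

Definition cl_input (R : realType) n m p r (B : 'M[R]_(n, m))
    (L : 'M[R]_(r, p)) (N : 'M[R]_(m, p)) : 'M[R]_(n + r, m + p) :=
  block_mx B (B *m N) 0 L.

Definition cl_output (R : realType) n m p r (C : 'M[R]_(p, n))
    (M : 'M[R]_(m, r)) (N : 'M[R]_(m, p)) : 'M[R]_(p + m, n + r) :=
  block_mx C 0 (N *m C) M.

Definition cl_feed (R : realType) m p (N : 'M[R]_(m, p)) : 'M[R]_(p + m, m + p) :=
  block_mx 0 0 0 N.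

Definition hinf_achievable (R : realType) n m p (A : 'M[R]_n) (B : 'M[R]_(n, m))
    (C : 'M[R]_(p, n)) (g : R) : Prop :=
  exists (r : nat) (K : 'M[R]_r) (L : 'M[R]_(r, p)) (M : 'M[R]_(m, r))
    (N : 'M[R]_(m, p)),
    hurwitz (cl_state A B C K L M N) /\
    (hinf_norm (cl_state A B C K L M N) (cl_input B L N) (cl_output C M N)
               (cl_feed N) < g%:E)%E.

(* The set of achievable levels has no least element, because the bound on the
   norm is strict: "smallest" means infimum (+oo if no level is achievable). *)
Definition hinf_opt (R : realType) n m p (A : 'M[R]_n) (B : 'M[R]_(n, m))
    (C : 'M[R]_(p, n)) : \bar R :=
  ereal_inf [set g%:E | g in [set g | hinf_achievable A B C g]].

Definition filter_are_solution (R : realType) n m p (eta : R) (A : 'M[R]_n)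
    (B : 'M[R]_(n, m)) (C : 'M[R]_(p, n)) (Y : 'M[R]_n) : Prop :=
  [/\ posdef Y,
      A *m Y + Y *m A^T + B *m B^T - eta *: (Y *m C^T *m C *m Y) = 0
    & hurwitz (A - eta *: (Y *m C^T *m C))].

Definition control_are_solution (R : realType) n m p (eta : R) (A : 'M[R]_n)
    (B : 'M[R]_(n, m)) (C : 'M[R]_(p, n)) (X : 'M[R]_n) : Prop :=
  [/\ posdef X,
      A^T *m X + X *m A + C^T *m C - eta *: (X *m B *m B^T *m X) = 0
    & hurwitz (A - eta *: (B *m B^T *m X))].

Definition quad_drift (R : realType) n (A : 'M[R]_n) (F : 'M[R]_(n, n ^ 2))
    (x : 'cV[R]_n) : 'cV[R]_n :=
  A *m x + F *m (tensmx x x : 'cV[R]_(n ^ 2)).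

(* Input u in L_2(-oo, 0] with a (Caratheodory) trajectory x of
   x' = A x + F (x (x) x) + B u such that x(-oo) = 0 and x(0) = x0.  Only the
   values of u and x on ]-oo, 0] matter. *)
Definition past_trajectory (R : realType) n m (A : 'M[R]_n) (F : 'M[R]_(n, n ^ 2))
    (B : 'M[R]_(n, m)) (x0 : 'cV[R]_n) (u : R -> 'cV[R]_m) (x : R -> 'cV[R]_n) : Prop :=
  (forall i, measurable_fun `]-oo, (0 : R)] (fun t => u t i 0)) /\
  (\int[lebesgue_measure]_(t in `]-oo, (0%R : R)]) (sqnorm (u t))%:E < +oo)%E /\
  {within `]-oo, (0 : R)], continuous x} /\
  (forall s t : R, s <= t -> t <= 0 -> forall i,
    x t i 0 - x s i 0 =
      \int[lebesgue_measure]_(tau in `[s, t])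
        ((quad_drift A F (x tau) + B *m u tau) i 0)) /\
  x t @[t --> -oo] --> (0 : 'cV[R]_n) /\
  x 0 = x0.

(* Extended-real valued, but never of the form +oo - oo: u is square integrable,
   so at most one of the positive and negative parts has an infinite integral. *)
Definition past_cost (R : realType) n m p (eta : R) (C : 'M[R]_(p, n))
    (u : R -> 'cV[R]_m) (x : R -> 'cV[R]_n) : \bar R :=
  ((2^-1)%:E * \int[lebesgue_measure]_(t in `]-oo, (0%R : R)])
                 (eta * sqnorm (C *m x t) + sqnorm (u t))%:E)%E.

Definition past_energy_at (R : realType) n m p (eta : R) (A : 'M[R]_n)
    (F : 'M[R]_(n, n ^ 2)) (B : 'M[R]_(n, m)) (C : 'M[R]_(p, n))
    (x0 : 'cV[R]_n) (e : R) : Prop :=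
  (exists u x, past_trajectory A F B x0 u x /\ past_cost eta C u x = e%:E) /\
  (forall u x, past_trajectory A F B x0 u x -> (e%:E <= past_cost eta C u x)%E).

Definition grad (R : realType) n (E : 'cV[R]_n -> R) (x : 'cV[R]_n) : 'rV[R]_n :=
  \row_i 'D_(delta_mx i 0 : 'cV[R]_n) E x.

Fixpoint class_C (R : realType) n (k : nat) (U : set 'cV[R]_n) (f : 'cV[R]_n -> R) : Prop :=
  match k with
  | 0 => forall x, U x -> {for x, continuous f}
  | k'.+1 => (forall x, U x -> differentiable f x) /\
             forall i : 'I_n, class_C k' U ('D_(delta_mx i 0 : 'cV[R]_n) f)
  end.

Definition smooth_near0 (R : realType) n (f : 'cV[R]_n -> R) : Prop :=
  exists U : set 'cV[R]_n, [/\ open U, U 0 & forall k, class_C k U f].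

(* sum_{k <= d} D^k f(0)[x, ..., x] / k! *)
Definition taylor0 (R : realType) n (d : nat) (f : 'cV[R]_n -> R) (x : 'cV[R]_n) : R :=
  \sum_(k < d.+1) (k`!)%:R^-1 * iter k (fun g : 'cV[R]_n -> R => 'D_x g) f 0.

Definition forward_trajectory (R : realType) n (f : 'cV[R]_n -> 'cV[R]_n)
    (x : R -> 'cV[R]_n) : Prop :=
  {within `[(0 : R), +oo[, continuous x} /\
  forall t : R, 0 < t -> is_derive t (1 : R) x (f (x t)).

(* Trajectories starting near 0 exist for all forward times, stay close to 0,
   and tend to 0. *)
Definition asymptotically_stable (R : realType) n (f : 'cV[R]_n -> 'cV[R]_n) : Prop :=
  [/\ \forall x0 \near (0 : 'cV[R]_n), exists2 x, forward_trajectory f x & x 0 = x0,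
      forall e : R, 0 < e -> exists2 delta : R, 0 < delta &
        forall x, forward_trajectory f x -> `|x 0| < delta ->
          forall t, 0 <= t -> `|x t| < e
    & exists2 delta : R, 0 < delta &
        forall x, forward_trajectory f x -> `|x 0| < delta ->
          x t @[t --> +oo] --> (0 : 'cV[R]_n)].

Definition past_HJB (R : realType) n m p (eta : R) (A : 'M[R]_n)
    (F : 'M[R]_(n, n ^ 2)) (B : 'M[R]_(n, m)) (C : 'M[R]_(p, n))
    (E : 'cV[R]_n -> R) (x : 'cV[R]_n) : Prop :=
  0 = grad E x *m quad_drift A F x
      + 2^-1 *: (grad E x *m B *m B^T *m (grad E x)^T)
      - (eta / 2) *: (x^T *m C^T *m C *m x).

Definition past_field (R : realType) n m (A : 'M[R]_n) (F : 'M[R]_(n, n ^ 2))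
    (B : 'M[R]_(n, m)) (E : 'cV[R]_n -> R) (x : 'cV[R]_n) : 'cV[R]_n :=
  - (quad_drift A F x + B *m B^T *m (grad E x)^T).

(* The energy function is the minimum of the cost, together with the standing
   assumptions: smoothness near 0, and characterization through the HJB
   equation and asymptotic stability. *)
Definition is_past_energy (R : realType) n m p (eta : R) (A : 'M[R]_n)
    (F : 'M[R]_(n, n ^ 2)) (B : 'M[R]_(n, m)) (C : 'M[R]_(p, n))
    (E : 'cV[R]_n -> R) : Prop :=
  (\forall x0 \near (0 : 'cV[R]_n), past_energy_at eta A F B C x0 (E x0)) /\
  smooth_near0 E /\
  E 0 = 0 /\
  (\forall x \near (0 : 'cV[R]_n), past_HJB eta A F B C E x) /\
  asymptotically_stable (past_field A F B E).

(* Main.v *)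
(** Restricted to a line [t |-> t *: x], the Hamilton-Jacobi-Bellman equation
    becomes a polynomial identity in [t] up to [O(t^(d+1))]; its coefficient of
    [t^2] is the Riccati equation for [V2] and its coefficient of [t^k] is the
    linear system of degree [k], evaluated at [x (x) ... (x) x].  The Taylor
    coefficients of the gradient are those of the formal gradient of the Taylor
    polynomial because directional derivatives commute.

    The matrix [P = Yinf^-1] solves the same Riccati equation and
    [-(A + B B^T P)] is Hurwitz.  With [D = P - V2] and [S] solving the Lyapunov
    equation of [-(A + B B^T P)], the form [H = c D - S] with [c] large has a
    definite derivative along the linearization of the past vector field, so a
    direction where [D] is positive would make [x^T H x] a Chetaev function,
    against asymptotic stability.  Hence [D <= 0], and [-D] is then a
    nonnegative solution of a Lyapunov inequality that forces [D = 0].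

    The [k]-way Lyapunov matrix is a sum of commuting matrices whose eigenvalues
    have positive real parts, hence it is invertible.  It preserves the space of
    tensors orthogonal to all [x (x) ... (x) x], and so does its inverse, being
    a polynomial in it: this gives uniqueness up to symmetrization. *)
Require Import Defs.
From HB Require Import structures.
From mathcomp Require Import all_boot all_order all_algebra all_fingroup.
From mathcomp Require Import all_classical all_reals all_analysis.
From mathcomp Require Import complex mxtens.
From mathcomp Require Import ring lra zify.

Set Implicit Arguments.
Unset Strict Implicit.
Unset Printing Implicit Defensive.

Import Order.TTheory GRing.Theory Num.Theory.
Import numFieldNormedType.Exports.

Local Open Scope classical_set_scope.
Local Open Scope ring_scope.

(** * Kronecker products and Lyapunov matrices *)

Section Recast.
Variable T : nmodType.

Lemma recast_id m n (M : 'M[T]_(m, n)) : recast M = M.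
Proof. exact: conform_mx_id. Qed.

Lemma recast_recast m1 n1 m2 n2 m3 n3 (M : 'M[T]_(m1, n1)) :
  m1 = m2 -> n1 = n2 ->
  recast (recast M : 'M[_]_(m2, n2)) = recast M :> 'M[T]_(m3, n3).
Proof. by move=> em en; case: m2 / em; case: n2 / en; rewrite recast_id. Qed.

Lemma recast_sum m1 n1 m2 n2 I (r : seq I) (P : pred I) (M : I -> 'M[T]_(m1, n1)) :
  m1 = m2 -> n1 = n2 ->
  recast (\sum_(i <- r | P i) M i) = \sum_(i <- r | P i) recast (M i)
    :> 'M[_]_(m2, n2).
Proof.
move=> em en; case: m2 / em; case: n2 / en; rewrite recast_id.
by apply: eq_bigr => i _; rewrite recast_id.
Qed.

(** Indices are compared by value only, so entries of a transported matrix are computed by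
    arithmetic on indices rather than by casts of ordinals. *)
Lemma recastE_ord m1 n1 m2 n2 (em : m1 = m2) (en : n1 = n2)
    (M : 'M[T]_(m1, n1)) (i : 'I_m2) (j : 'I_n2) (i' : 'I_m1) (j' : 'I_n1) :
  i = i' :> nat -> j = j' :> nat ->
  (recast M : 'M[T]_(m2, n2)) i j = M i' j'.
Proof.
case: m2 / em i => i; case: n2 / en j => j ei ej.
by rewrite recast_id; congr (M _ _); apply: val_inj.
Qed.

End Recast.

Lemma map_recast (T S : nmodType) (f : {additive T -> S}) m1 n1 m2 n2
    (M : 'M[T]_(m1, n1)) :
  m1 = m2 -> n1 = n2 ->
  map_mx f (recast M : 'M[_]_(m2, n2)) = recast (map_mx f M).
Proof. by move=> em en; case: m2 / em; case: n2 / en; rewrite !recast_id. Qed.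

Section RecastMul.
Variable T : pzRingType.

Lemma mul_recast m n p m' n' p' (A : 'M[T]_(m, n)) (B : 'M[T]_(n, p)) :
  m = m' -> n = n' -> p = p' ->
  (recast A : 'M[_]_(m', n')) *m (recast B : 'M[_]_(n', p')) = recast (A *m B).
Proof.
by move=> em en ep; case: m' / em; case: n' / en; case: p' / ep; rewrite !recast_id.
Qed.

Lemma tr_recast m1 n1 m2 n2 (M : 'M[T]_(m1, n1)) :
  m1 = m2 -> n1 = n2 ->
  (recast M : 'M[_]_(m2, n2))^T = recast M^T.
Proof. by move=> em en; case: m2 / em; case: n2 / en; rewrite !recast_id. Qed.

Lemma tens_recastr m1 n1 m2 n2 m2' n2' m' n' (A : 'M[T]_(m1, n1)) (B : 'M[T]_(m2, n2)) :
  m2 = m2' -> n2 = n2' ->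
  recast (tensmx A (recast B : 'M[_]_(m2', n2'))) = recast (tensmx A B) :> 'M[_]_(m', n').
Proof. by move=> em en; case: m2' / em; case: n2' / en; rewrite !recast_id. Qed.

Lemma tens_recastl m1 n1 m2 n2 m1' n1' m' n' (A : 'M[T]_(m1, n1)) (B : 'M[T]_(m2, n2)) :
  m1 = m1' -> n1 = n1' ->
  recast (tensmx (recast A : 'M[_]_(m1', n1')) B) = recast (tensmx A B) :> 'M[_]_(m', n').
Proof. by move=> em en; case: m1' / em; case: n1' / en; rewrite !recast_id. Qed.

(** Both bracketings number a triple of indices by the same mixed-radix integer; only the types
    differ. *)
Lemma tensmx_assoc m1 n1 m2 n2 m3 n3 (A : 'M[T]_(m1, n1)) (B : 'M[T]_(m2, n2))
    (C : 'M[T]_(m3, n3)) :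
  tensmx A (tensmx B C) = recast (tensmx (tensmx A B) C).
Proof.
apply/matrixP => i j.
case: (mxtens_indexP i) => i1 i'; case: (mxtens_indexP i') => i2 i3 {i i'}.
case: (mxtens_indexP j) => j1 j'; case: (mxtens_indexP j') => j2 j3 {j j'}.
rewrite (@recastE_ord _ _ _ _ _ _ _ _ _ _ (mxtens_index (mxtens_index (i1, i2), i3))
  (mxtens_index (mxtens_index (j1, j2), j3))) ?mulnA //=; last 2 first.
- by rewrite mulnDl mulnA addnA.
- by rewrite mulnDl mulnA addnA.
by rewrite !tensmxE mulrA.
Qed.

Lemma tens1mx m n (M : 'M[T]_(m, n)) :
  tensmx (const_mx 1 : 'cV_1) M = recast M.
Proof.
apply/matrixP => i j.
case: (mxtens_indexP i) => i1 i2; case: (mxtens_indexP j) => j1 j2.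
rewrite (@recastE_ord _ _ _ _ _ _ _ _ _ _ i2 j2) ?mul1n //=.
- by rewrite tensmxE mxE mul1r.
- by rewrite [i1]ord1 mul0n.
- by rewrite [j1]ord1 mul0n.
Qed.

End RecastMul.

Lemma expn_at n k i : (i < k)%N -> (n ^ k = n ^ i * (n * n ^ (k - i.+1)))%N.
Proof. by move=> ik; rewrite lyap_dim_col. Qed.

(** * Kronecker products of sequences of vectors *)

Section Kron.
Variable T : pzRingType.
Variable n : nat.
Implicit Types (a : nat -> 'cV[T]_n) (k : nat).

Definition kron_seq k a : 'cV[T]_(n ^ k) := kron (fun i : 'I_k => a i).

Lemma kron_seq_ext k a b : (forall i, (i < k)%N -> a i = b i) ->
  kron_seq k a = kron_seq k b.
Proof. by move=> ab; congr kron; apply/funext => i; apply: ab. Qed.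

Lemma kron_seqS k a :
  kron_seq k.+1 a = recast (tensmx (a 0%N) (kron_seq k (fun i => a i.+1))).
Proof. by []. Qed.

Lemma kron_seq_cast k k' a : k = k' -> kron_seq k' a = recast (kron_seq k a).
Proof. by move=> ->; rewrite recast_id. Qed.

Lemma kron_seq_cat p q a :
  kron_seq (p + q) a =
  recast (tensmx (kron_seq p a) (kron_seq q (fun i => a (p + i)%N))).
Proof.
elim: p a => [|p IH] a.
  by rewrite tens1mx recast_recast ?mul1n ?recast_id.
rewrite [kron_seq (p.+1 + q) a]kron_seqS IH.
rewrite tens_recastr ?expnD ?muln1 // tensmx_assoc recast_recast ?mulnA ?muln1 //.
by rewrite kron_seqS tens_recastl ?expnS ?muln1.
Qed.

(** The bracketing is that of the summands of [lyap], so that the mixed-product rule applies factor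
    by factor. *)
Lemma kron_seq_at k i a : (i < k)%N ->
  kron_seq k a = recast (tensmx (kron_seq i a)
     (tensmx (a i) (kron_seq (k - i.+1) (fun j => a (i.+1 + j)%N)))).
Proof.
move=> ik; have e : (i + (k - i.+1).+1)%N = k by lia.
rewrite (kron_seq_cast a e) kron_seq_cat kron_seqS.
rewrite recast_recast ?e // -?expnD ?e ?muln1 //.
rewrite tens_recastr ?expnS ?muln1 ?addn0 //.
congr (recast (tensmx _ (tensmx _ _))).
by apply: kron_seq_ext => j _; rewrite addnS addSn.
Qed.

(** The base [n] digits of [l] select the factors. Hence elementary tensors contain the standard
    basis, and identities between matrices can be checked on them. *)
Lemma kron_seq_delta k (l : 'I_(n ^ k)) : exists a, kron_seq k a = delta_mx l 0.
Proof.
elim: k l => [|k IH] l.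
  (* The empty product is 1 whatever the sequence, so any witness serves. *)
  exists (fun=> 0); apply/matrixP => i j; rewrite !mxE.
  have -> : i = l by apply: val_inj; case: i l => [[|i] //= ?] [[|l] //= ?].
  by rewrite [j]ord1 !eqxx.
have e : (n ^ k.+1 = n * n ^ k)%N by rewrite expnS.
have [i [j lE]] : exists (i : 'I_n) (j : 'I_(n ^ k)), l = (i * n ^ k + j)%N :> nat.
  exists (mxtens_unindex (cast_ord e l)).1, (mxtens_unindex (cast_ord e l)).2.
  exact: divn_eq.
have [a aE] := IH j.
exists (fun m => if m is m'.+1 then a m' else delta_mx i 0).
rewrite kron_seqS /= aE; apply/matrixP => r c; rewrite [c]ord1.
have -> : r = cast_ord (esym e) (cast_ord e r) by apply: val_inj.
case: (mxtens_indexP (cast_ord e r)) => i' j'.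
rewrite (@recastE_ord _ _ _ _ _ _ _ _ _ _ (mxtens_index (i', j'))
  (mxtens_index (ord0, ord0))) ?expnS //.
rewrite tensmxE !mxE !eqxx !andbT -natrM mulnb; congr (_%:R); congr nat_of_bool.
by rewrite -[RHS]val_eqE /= lE eq_addl_mul.
Qed.

Lemma kron_seq_inj k q (M N : 'M[T]_(q, n ^ k)) :
  (forall a, M *m kron_seq k a = N *m kron_seq k a) -> M = N.
Proof.
move=> MN; apply/matrixP => i l; have [a aE] := kron_seq_delta l.
by move: (MN a); rewrite aE -!colE => /matrixP /(_ i 0); rewrite !mxE.
Qed.

End Kron.

(* The factor [y] is put at position [i]; sequences indexed by [nat] avoid casts
   between ordinals when Kronecker products are split. *)
Definition set_slot (T : Type) (a : nat -> T) (i : nat) (y : T) (j : nat) : T :=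
  if j == i then y else a j.

(** * Matrices acting on a single tensor factor *)

Section Slot.
Variable T : comPzRingType.
Variable n : nat.
Implicit Types (a : nat -> 'cV[T]_n) (k : nat).

(** Mixed-product rule. The outer dimension is a variable [N] because the transposed summands of
    [lyap] carry it as [n ^ k.-1 * q], the square ones as [n ^ k]. *)
Lemma tens_slot k q i (M : 'M[T]_(n, q)) (y : 'cV[T]_q) a N : (i < k)%N ->
  (n ^ i * (q * n ^ (k - i.+1)) = N)%N ->
  (recast (tensmx (1%:M : 'M[_]_(n ^ i)) (tensmx M (1%:M : 'M[_]_(n ^ (k - i.+1)))))
     : 'M[_]_(n ^ k, N)) *m
  recast (tensmx (kron_seq i a)
     (tensmx y (kron_seq (k - i.+1) (fun j => a (i.+1 + j)%N))))
  = kron_seq k (set_slot a i (M *m y)).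
Proof.
move=> ik eN; rewrite mul_recast ?lyap_dim_col ?muln1 //.
rewrite !tensmx_mul !mul1mx (kron_seq_at _ ik) /set_slot eqxx.
congr (recast (tensmx _ (tensmx _ _))).
  by apply: kron_seq_ext => j ji; rewrite ltn_eqF.
by apply: kron_seq_ext => j _; rewrite gtn_eqF // leq_addr.
Qed.

(** A summand of the Lyapunov matrix, typed as a square matrix so that products, inverses and
    eigenvalues make sense. *)
Definition slotmx k i (M : 'M[T]_n) : 'M[T]_(n ^ k) :=
  recast (tensmx (1%:M : 'M[_]_(n ^ i)) (tensmx M (1%:M : 'M[_]_(n ^ (k - i.+1))))).

Lemma slotmx_kron k i M a : (i < k)%N ->
  slotmx k i M *m kron_seq k a = kron_seq k (set_slot a i (M *m a i)).
Proof.
by move=> ik; rewrite {1}(kron_seq_at a ik) /slotmx tens_slot // lyap_dim_col.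
Qed.

Lemma slotmxB k i M N : (i < k)%N ->
  slotmx k i (M - N) = slotmx k i M - slotmx k i N.
Proof.
move=> ik; have e := expn_at n ik.
rewrite /slotmx !(recastE (esym e, esym e)); apply/matrixP => r c.
by rewrite !(castmxE, mxE) mulrBl mulrBr.
Qed.

Lemma slotmxZ k i c M : (i < k)%N -> slotmx k i (c *: M) = c *: slotmx k i M.
Proof.
move=> ik; have e := expn_at n ik.
rewrite /slotmx !(recastE (esym e, esym e)); apply/matrixP => r s.
by rewrite !(castmxE, mxE) -!mulrA mulrCA.
Qed.

Lemma slotmx1 k i : (i < k)%N -> slotmx k i 1%:M = 1%:M.
Proof.
move=> ik; apply: kron_seq_inj => a; rewrite slotmx_kron // !mul1mx.
by apply: kron_seq_ext => j _; rewrite /set_slot; case: eqP => // ->.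
Qed.

Lemma slotmxM k i M N : (i < k)%N ->
  slotmx k i M *m slotmx k i N = slotmx k i (M *m N).
Proof.
move=> ik; apply: kron_seq_inj => a; rewrite -mulmxA !slotmx_kron //.
apply: kron_seq_ext => j _; rewrite /set_slot eqxx mulmxA.
by case: eqP.
Qed.

(** On an elementary tensor the two matrices modify different factors. *)
Lemma slotmxC k i j M N : (i < k)%N -> (j < k)%N -> i != j ->
  slotmx k i M *m slotmx k j N = slotmx k j N *m slotmx k i M.
Proof.
move=> ik jk ij; apply: kron_seq_inj => a; rewrite -!mulmxA !slotmx_kron //.
apply: kron_seq_ext => l _; rewrite /set_slot (eq_sym j i) (negbTE ij).
by case: eqP => // ->; rewrite (negbTE ij).
Qed.

Lemma lyap_sq k (M : 'M[T]_n) : (0 < k)%N ->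
  recast (lyap k M) = \sum_(i < k) slotmx k i M.
Proof.
move=> k0; rewrite /lyap recast_sum ?lyap_dim_sq //.
apply: eq_bigr => i _.
by rewrite recast_recast ?lyap_dim_row ?lyap_dim_sq.
Qed.

(** The hypothesis asks that [z] be the same tensor whichever position [y] is inserted at. It covers
    both [y = x] (linear drift) and [y] the square of [x] (quadratic drift). *)
Lemma lyap_kron k q (M : 'M[T]_(n, q)) (x : 'cV[T]_n) (y : 'cV[T]_q) z :
  (forall i, (i < k)%N -> z = recast (tensmx (kpow x i)
      (tensmx y (kpow x (k - i.+1))))) ->
  (lyap k M^T)^T *m z = \sum_(i < k) kron_seq k (set_slot (fun=> x) i (M *m y)).
Proof.
move=> zE; rewrite /lyap linear_sum /= mulmx_suml; apply: eq_bigr => i _.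
rewrite tr_recast ?lyap_dim_row ?lyap_dim_sq ?(leq_ltn_trans _ (ltn_ord i)) // !trmx_tens !trmx1 trmxK.
by rewrite (zE i) // -(tens_slot M y (fun=> x) (ltn_ord i) (lyap_dim_row _ _ (ltn_ord i))).
Qed.

End Slot.

(** * Evaluation of tensors on powers of a vector *)

Section KronEval.
Variable T : comNzRingType.
Implicit Types n k : nat.

Lemma tensmx_const1 m n (M : 'M[T]_(m, n)) :
  tensmx M (const_mx 1 : 'cV_1) = recast M.
Proof.
apply/matrixP => i j.
case: (mxtens_indexP i) => i1 i2; case: (mxtens_indexP j) => j1 j2.
rewrite (@recastE_ord _ _ _ _ _ _ _ _ _ _ i1 j1) ?muln1 //=.
- by rewrite tensmxE mxE mulr1.
- by rewrite [i2]ord1 ?muln1 addn0.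
- by rewrite [j2]ord1 ?muln1 addn0.
Qed.

Lemma kron_seq1 n (a : nat -> 'cV[T]_n) : kron_seq 1 a = recast (a 0%N).
Proof. by rewrite kron_seqS tensmx_const1 recast_recast ?muln1. Qed.

Lemma kpow_cat n (x : 'cV[T]_n) p q k : (p + q)%N = k ->
  kpow x k = recast (tensmx (kpow x p) (kpow x q)).
Proof. by move=> <-; exact: kron_seq_cat. Qed.

(** The transposition of [i] and [j] moves [y] and otherwise exchanges copies of [x]. *)
Lemma sym_set_slot n k (v : 'cV[T]_(n ^ k)) x y i j : sym_tensor v ->
  (i < k)%N -> (j < k)%N ->
  v^T *m kron_seq k (set_slot (fun=> x) i y) =
  v^T *m kron_seq k (set_slot (fun=> x) j y).
Proof.
move=> vsym ik jk; set s := tperm (Ordinal ik) (Ordinal jk).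
rewrite /kron_seq (vsym _ s); congr (_ *m kron _); apply/funext => l.
rewrite /set_slot; have := inj_eq (@perm_inj _ s) l (Ordinal jk).
by rewrite tpermR -!val_eqE /= => ->.
Qed.

(** Column stacking makes the column index the leading digit, hence [a] comes first in the tensor
    and last in the matrix product. *)
Lemma vec_tens m p (V : 'M[T]_(m, p)) (a : 'cV[T]_p) (b : 'cV[T]_m) :
  ((vec V)^T *m (tensmx a b : 'cV_(p * m))) 0 0 = (b^T *m V *m a) 0 0.
Proof.
rewrite mxE (reindex (@mxtens_index p m)); last first.
  by exists (@mxtens_unindex p m) => i _; rewrite (mxtens_indexK, mxtens_unindexK).
transitivity (\sum_i \sum_j V j i * (a i 0 * b j 0)).
  rewrite pair_bigA; apply: eq_bigr => -[i j] _ /=.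
  rewrite !mxE !mxtens_indexK /=.
  by congr (_ * (a _ _ * b _ _)); exact: ord1.
rewrite mxE; apply: eq_bigr => i _; rewrite mxE mulr_suml; apply: eq_bigr => j _.
by rewrite mxE mulrCA mulrC [b _ _ * _]mulrC.
Qed.

Lemma recast_tr_mul m m' p (w : 'cV[T]_m) (z : 'M[T]_(m', p)) : m = m' ->
  (recast w : 'cV_m')^T *m z = w^T *m recast z.
Proof. by move=> e; case: m' / e z => z; rewrite !recast_id. Qed.

(** Symmetry allows [y] to be moved to the last position, where [vec_tens] reads it as the row
    argument of [V]. *)
Lemma vec_set_slot n k (v : 'cV[T]_(n ^ k)) (V : 'M[T]_(n, n ^ k.-1)) x y i :
  sym_tensor v -> v = recast (vec V) -> (i < k)%N ->
  (v^T *m kron_seq k (set_slot (fun=> x) i y)) 0 0 =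
  (y^T *m V *m kpow x k.-1) 0 0.
Proof.
case: k v V => // k v V vsym vE ik; rewrite (sym_set_slot x y vsym ik (ltnSn k)).
have ek : (n ^ k * n = n ^ k.+1)%N by rewrite expnSr.
rewrite (kron_seq_cast _ (addn1 k)) kron_seq_cat kron_seq1 addn0.
rewrite recast_recast ?muln1 //; last by rewrite -expnD.
rewrite tens_recastr ?expn1 // vE.
rewrite (recast_tr_mul _ _ ek) recast_recast // recast_id.
rewrite vec_tens /set_slot eqxx; congr ((_ *m _) _ _).
by apply: kron_seq_ext => j jk; rewrite ltn_eqF.
Qed.

Lemma kron_seq_entry n k (l : 'I_(n ^ k.+1)) : exists (i : 'I_n) (j : 'I_(n ^ k)),
  forall a : nat -> 'cV[T]_n,
    kron_seq k.+1 a l 0 = a 0%N i 0 * kron_seq k (fun i => a i.+1) j 0.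
Proof.
have e : (n ^ k.+1 = n * n ^ k)%N by rewrite expnS.
exists (mxtens_unindex (cast_ord e l)).1, (mxtens_unindex (cast_ord e l)).2 => a.
rewrite kron_seqS (@recastE_ord _ _ _ _ _ _ _ _ _ _ (cast_ord e l)
  (mxtens_index (ord0, ord0))) ?expnS //.
by rewrite -[in LHS](mxtens_unindexK (cast_ord e l)) tensmxE.
Qed.

(** The product rule in algebraic form: the linear coefficient in [s] is the derivative of the
    tensor power in direction [y], one term per factor. *)
Lemma kpow_line n k (x y : 'cV[T]_n) (l : 'I_(n ^ k)) : exists p : {poly T},
  [/\ forall s, kpow (x + s *: y) k l 0 = p.[s],
      p`_0 = kpow x k l 0
    & p`_1 = \sum_(i < k) kron_seq k (set_slot (fun=> x) i y) l 0].
Proof.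
elim: k l => [|k IH] l.
  exists 1; split=> [s||]; first by rewrite hornerE mxE.
    by rewrite coefC mxE.
  by rewrite coefC big_ord0.
have [i [j ij]] := kron_seq_entry l; have [p [pE p0 p1]] := IH j.
exists (((x i 0)%:P + (y i 0)%:P * 'X) * p); split=> [s||].
- by rewrite [LHS](ij (fun=> x + s *: y)) hornerE -pE !hornerE !mxE [s * _]mulrC.
- by rewrite coef0M coefD coefC coefMX /= addr0 p0 [RHS](ij (fun=> x)).
rewrite coefM big_ord_recl big_ord1 /= !coefD !coefC !coefMX /= coefC.
rewrite addr0 add0r subn0 subnn p0 p1.
rewrite [RHS]big_ord_recl /= addrC; congr (_ + _); first by rewrite ij.
rewrite mulr_sumr; apply: eq_bigr => r _; rewrite ij.
by congr (_ * _).
Qed.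

Lemma mul_kpow_line n k (w : 'cV[T]_(n ^ k)) x y : exists p : {poly T},
  [/\ forall s, (w^T *m kpow (x + s *: y) k) 0 0 = p.[s],
      p`_0 = (w^T *m kpow x k) 0 0
    & p`_1 = \sum_(i < k) (w^T *m kron_seq k (set_slot (fun=> x) i y)) 0 0].
Proof.
have [P PE] := choice (@kpow_line n k x y).
exists (\sum_l (w l 0) *: P l); split=> [s||].
- rewrite mxE horner_sum; apply: eq_bigr => l _.
  by rewrite hornerZ mxE; have [-> _ _] := PE l.
- rewrite mxE coef_sum; apply: eq_bigr => l _.
  by rewrite coefZ mxE; have [_ -> _] := PE l.
under [RHS]eq_bigr do rewrite mxE.
rewrite coef_sum exchange_big /=; apply: eq_bigr => l _.
rewrite coefZ; have [_ _ ->] := PE l; rewrite mulr_sumr; apply: eq_bigr => i _.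
by rewrite mxE.
Qed.

Lemma sym_kpow_line n k (v : 'cV[T]_(n ^ k)) (V : 'M[T]_(n, n ^ k.-1)) x y :
  sym_tensor v -> v = recast (vec V) ->
  exists p : {poly T},
  [/\ forall s, (v^T *m kpow (x + s *: y) k) 0 0 = p.[s],
      p`_0 = (v^T *m kpow x k) 0 0
    & p`_1 = k%:R * (y^T *m V *m kpow x k.-1) 0 0].
Proof.
move=> vs vE; have [p [pE p0 p1]] := mul_kpow_line v x y.
exists p; split=> //; rewrite p1.
rewrite (eq_bigr (fun=> (y^T *m V *m kpow x k.-1) 0 0)).
  by rewrite sumr_const card_ord mulr_natl.
by move=> i _; exact: vec_set_slot.
Qed.

(** The transposed Lyapunov matrix sends the tensor power of [x] to its derivative in direction
    [A *m x]. *)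
Lemma lyap_kpow_slots n k (A : 'M[T]_n) (w : 'cV[T]_(n ^ k)) x : (0 < k)%N ->
  (recast (lyap k A^T *m w) : 'cV_(n ^ k))^T *m kpow x k =
  \sum_(i < k) w^T *m kron_seq k (set_slot (fun=> x) i (A *m x)).
Proof.
move=> k0; rewrite recast_tr_mul ?lyap_dim_sq // trmx_mul -mulmxA.
rewrite (@lyap_kron _ _ _ _ _ x x) => [|i ik]; last first.
  rewrite {1}/kpow -/(kron_seq k (fun=> x)) (kron_seq_at _ ik) recast_recast //.
  by rewrite lyap_dim_col.
by rewrite mulmx_sumr.
Qed.

Lemma lyap_kpow n k (A : 'M[T]_n) (v : 'cV[T]_(n ^ k)) (V : 'M[T]_(n, n ^ k.-1)) x :
  sym_tensor v -> v = recast (vec V) -> (0 < k)%N ->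
  ((recast (lyap k A^T *m v) : 'cV_(n ^ k))^T *m kpow x k) 0 0 =
  k%:R * ((A *m x)^T *m V *m kpow x k.-1) 0 0.
Proof.
move=> vs vE k0; rewrite lyap_kpow_slots // summxE.
rewrite (eq_bigr (fun=> ((A *m x)^T *m V *m kpow x k.-1) 0 0)).
  by rewrite sumr_const card_ord mulr_natl.
by move=> i _; exact: vec_set_slot.
Qed.

Lemma lyap_kpow_quad n k (F : 'M[T]_(n, n ^ 2)) (v : 'cV[T]_(n ^ k))
    (V : 'M[T]_(n, n ^ k.-1)) x :
  sym_tensor v -> v = recast (vec V) -> (0 < k)%N ->
  ((recast (lyap k F^T *m v) : 'cV_(n ^ k.+1))^T *m kpow x k.+1) 0 0 =
  k%:R * ((F *m (tensmx x x : 'cV_(n ^ 2)))^T *m V *m kpow x k.-1) 0 0.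
Proof.
move=> vs vE k0; have ek : (n ^ k.-1 * n ^ 2 = n ^ k.+1)%N.
  by rewrite -expnD addn2 prednK.
rewrite recast_tr_mul // trmx_mul -(mulmxA v^T).
(* A power of order [k.+1] can be read, for each [i], as [k] factors whose [i]-th one is the square
   of [x]. *)
rewrite (@lyap_kron _ _ _ _ _ x (tensmx x x : 'cV_(n ^ 2))) => [|i ik]; last first.
  rewrite (@kpow_cat _ _ i (2 + (k - i.+1))); last by lia.
  rewrite (@kpow_cat _ x 2 (k - i.+1) (2 + (k - i.+1)) erefl).
  rewrite recast_recast //; last by rewrite -!expnD; congr (_ ^ _)%N; lia.
  rewrite tens_recastr ?expnD //.
  congr (recast (tensmx _ (tensmx _ _))).
  by rewrite (@kpow_cat _ x 1 1 2 erefl) /kpow -/(kron_seq 1 (fun=> x)) kron_seq1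
    tens_recastl ?expn1 // tens_recastr ?expn1 // recast_id.
rewrite mulmx_sumr summxE
  (eq_bigr (fun=> ((F *m (tensmx x x : 'cV_(n ^ 2)))^T *m V *m kpow x k.-1) 0 0)).
  by rewrite sumr_const card_ord mulr_natl.
by move=> i _; exact: vec_set_slot.
Qed.

Lemma vec_kpow_quad n k i j (Q : 'M[T]_(n ^ i.-1, n ^ j.-1)) x :
  (2 < i)%N -> (2 < j)%N -> (i + j = k + 2)%N ->
  ((recast (vec Q) : 'cV_(n ^ k))^T *m kpow x k) 0 0 =
  ((kpow x i.-1)^T *m Q *m kpow x j.-1) 0 0.
Proof.
move=> i2 j2 ijk; rewrite recast_tr_mul ?(vec_mul_dim _ i2 j2 ijk) //.
rewrite (@kpow_cat _ _ j.-1 i.-1); last by lia.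
by rewrite recast_recast ?(vec_mul_dim _ i2 j2 ijk) // recast_id vec_tens.
Qed.

End KronEval.

(** * Spectrum and Lyapunov equations *)

Section CommonEigenvector.
Variable C : numClosedFieldType.

(** The restrictions to the row space of [V] still commute; a common eigenvector found there is
    carried back through a basis of that space. *)
Lemma common_eigenvector_in N (V : 'M[C]_N) (As : seq 'M[C]_N) :
  V != 0 -> {in As, forall A, stablemx V A} -> {in As &, forall A B, comm_mx A B} ->
  exists v : 'rV_N, [/\ v != 0, (v <= V)%MS & {in As, forall A, stablemx v A}].
Proof.
move=> V0 VAs Ac.
have [] := @common_eigenvector C _ [seq restrictmx V A | A <- As].
- by rewrite lt0n mxrank_eq0.
- move=> _ _ /mapP[A Ain ->] /mapP[B Bin ->].
  by rewrite /comm_mx -!conjmxM ?inE ?stablemx_row_base ?VAs // (Ac A B).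
move=> v v0 /allP vP; exists (v *m row_base V); split.
- by rewrite mulmx_free_eq0 ?row_base_free.
- by rewrite (submx_trans (submxMl _ _)) // eq_row_base.
move=> A Ain; rewrite -stablemx_restrict ?VAs // vP //.
by apply/mapP; exists A.
Qed.

Lemma eigenvalue_unitmx (F : fieldType) N (A : 'M[F]_N) a :
  eigenvalue A a = (A - a%:M \notin unitmx).
Proof. by rewrite /eigenvalue /eigenspace kermx_eq0 row_free_unit. Qed.

Lemma eigenvalue_trmx (F : fieldType) N (A : 'M[F]_N) a :
  eigenvalue A^T a = eigenvalue A a.
Proof.
rewrite !eigenvalue_unitmx; congr (~~ _).
by rewrite -unitmx_tr linearB /= trmxK tr_scalar_mx.
Qed.

End CommonEigenvector.

Section LinMulmx.
Variable F : fieldType.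
Variable n : nat.
Implicit Types A B : 'M[F]_n.

(** Multiplications on the left and on the right commute by associativity. *)
Lemma comm_lin_mulmx A B : comm_mx (lin_mulmx A) (lin_mulmxr B : 'M[F]_(n * n)).
Proof.
apply/row_matrixP => i; rewrite !rowE; move: (delta_mx 0 i) => u.
by rewrite !mulmxA -[u]vec_mxK !mul_vec_lin /= !mulmxA.
Qed.

Lemma eigenvalue_lin_mulmxr B z :
  eigenvalue (lin_mulmxr B : 'M[F]_(n * n)) z -> eigenvalue B z.
Proof.
move=> /eigenvalueP[w]; rewrite -[w]vec_mxK mul_vec_lin /= -linearZ /=.
move=> /(can_inj mxvecK) /eigenspaceP wB w0; apply: contra_neq w0 => B0.
by move: wB; rewrite B0 submx0 => /eqP ->; rewrite linear0.
Qed.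

Lemma eigenvalue_lin_mulmx A z :
  eigenvalue (lin_mulmx A : 'M[F]_(n * n)) z -> eigenvalue A^T z.
Proof.
move=> /eigenvalueP[w]; rewrite -[w]vec_mxK mul_vec_lin /= -linearZ /=.
move=> /(can_inj mxvecK) /(congr1 trmx); rewrite trmx_mul linearZ /=.
move=> /eigenspaceP wA w0; apply: contra_neq w0 => A0.
move: wA; rewrite A0 submx0 => /eqP /(congr1 trmx); rewrite trmxK => ->.
by rewrite trmx0 linear0.
Qed.

End LinMulmx.

Section HurwitzSum.
Variable R : rcfType.
Local Notation C := R[i].

(** If the sum were singular, its kernel, stable under each summand, would contain a common
    eigenvector. Its eigenvalue 0 for the sum would then be a sum of numbers with negative real
    part. *)
Lemma sum_comm_unitmx N (As : seq 'M[C]_N) : As != [::] ->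
  {in As &, forall A B, comm_mx A B} ->
  {in As, forall A z, eigenvalue A z -> complex.Re z < 0} ->
  \sum_(A <- As) A \in unitmx.
Proof.
move=> As0 Ac Aneg; set L := \sum_(A <- As) A.
have LA : {in As, forall A, comm_mx L A}.
  move=> A Ain; rewrite /comm_mx /L mulmx_suml mulmx_sumr.
  by apply: eq_big_seq => B Bin; apply: Ac.
apply: contraT => nL.
have L0 : eigenspace L 0 != 0.
  by have := eigenvalue_unitmx L 0; rewrite /eigenvalue -scalemx1 scale0r subr0 nL => ->.
have [v [v0 vL vAs]] := common_eigenvector_in L0
  (fun A Ain => comm_mx_stable_eigenspace _ (LA A Ain)) Ac.
(* The weak inequality serves the induction from the empty list; the strict one holds as soon as a
   summand is present. *)
have Bs (B : seq 'M[C]_N) : {subset B <= As} -> exists z,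
    [/\ v *m (\sum_(A <- B) A) = z *: v, complex.Re z <= 0 & (B != [::]) ==> (complex.Re z < 0)].
  elim: B => [|A B IH] BAs.
    by exists 0; rewrite big_nil mulmx0 scale0r lexx.
  have [z [zE zle zlt]] := IH (fun x xB => BAs x (mem_behead (s := A :: B) xB)).
  have Ain : A \in As by apply: BAs; rewrite mem_head.
  have /sub_rVP[a aE] := vAs _ Ain.
  have aneg : complex.Re a < 0.
    by apply: Aneg Ain _ _; apply/eigenvalueP; exists v.
  exists (a + z); rewrite big_cons mulmxDr aE zE scalerDl raddfD /=.
  by split => //; lra.
have [z [zE _ zlt]] := Bs As (fun _ h => h).
move: zlt; rewrite As0 /=; suff -> : z = 0 by rewrite ltxx.
have : v *m L = 0 by have /eigenspaceP := vL; rewrite scale0r.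
by rewrite zE => /eqP; rewrite scaler_eq0 (negbTE v0) orbF => /eqP.
Qed.

End HurwitzSum.

Section Hurwitz.
Variable R : realType.

Lemma hurwitz_trmx n (A : 'M[R]_n) : hurwitz A -> hurwitz A^T.
Proof.
by move=> Ah z; rewrite /toC -map_trmx eigenvalue_trmx; exact: Ah.
Qed.

Lemma map_slotmx n k i (M : 'M[R]_n) : (i < k)%N ->
  toC (slotmx k i M) = slotmx k i (toC M).
Proof.
move=> ik; rewrite /toC /slotmx map_recast ?lyap_dim_col //.
by rewrite !map_mxT !map_mx1.
Qed.

(** When [M - z%:M] is invertible, putting its inverse in the same slot inverts the slot matrix. *)
Lemma eigenvalue_slotmx (F : fieldType) n k i (M : 'M[F]_n) z : (i < k)%N ->
  eigenvalue (slotmx k i M) z -> eigenvalue M z.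
Proof.
move=> ik; rewrite !eigenvalue_unitmx; apply: contra => Mu.
have <- : slotmx k i (M - z%:M) = slotmx k i M - z%:M.
  by rewrite slotmxB // -scalemx1 slotmxZ // slotmx1 // scalemx1.
suff : slotmx k i (M - z%:M) *m slotmx k i (invmx (M - z%:M)) = 1%:M.
  by case/mulmx1_unit.
by rewrite slotmxM // mulmxV // slotmx1.
Qed.

Lemma lyap_unitmx n k (A : 'M[R]_n) : (0 < k)%N -> hurwitz (- A) ->
  \sum_(i < k) slotmx k i A^T \in unitmx.
Proof.
move=> k0 Ah.
have NA (i : 'I_k) : slotmx k i (- A)^T = - slotmx k i A^T.
  by rewrite linearN /= -scaleN1r slotmxZ // scaleN1r.
(* Changing the sign gives a sum of matrices with spectrum in the left half-plane; invertibility is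
   then tested over the complex numbers. *)
rewrite -[X in X \in _]opprK -sumrN -scaleN1r unitmxZ ?unitrN1 //.
rewrite -(map_unitmx (real_complex R)).
have -> : map_mx (real_complex R) (\sum_(i < k) - slotmx k i A^T) =
    \sum_(M <- [seq slotmx k (nat_of_ord i) (toC (- A)^T) | i : 'I_k]) M.
  rewrite big_image /= raddf_sum /=; apply: eq_bigr => i _.
  by rewrite -NA -[LHS]/(toC _) map_slotmx.
apply: sum_comm_unitmx.
- by rewrite -size_eq0 size_map -cardE card_ord -lt0n.
- move=> _ _ /mapP[i _ ->] /mapP[j _ ->]; rewrite /comm_mx.
  by have [->//|ij] := eqVneq i j; rewrite slotmxC.
move=> _ /mapP[i _ ->] z /eigenvalue_slotmx -/(_ (ltn_ord i)).
exact: hurwitz_trmx.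
Qed.

(** On vectorized matrices the left-hand side is a sum of two commuting operators, each with its
    eigenvalues among those of [M]. *)
Lemma lyapunov_solution n (M Q : 'M[R]_n) : hurwitz M ->
  exists S, M^T *m S + S *m M = Q.
Proof.
move=> Mh; pose L : 'M[R]_(n * n) := lin_mulmx M^T + lin_mulmxr M.
have Lu : L \in unitmx.
  rewrite -(map_unitmx (real_complex R)).
  have -> : map_mx (real_complex R) L =
      \sum_(K <- [:: lin_mulmx (toC M)^T; lin_mulmxr (toC M)]) K.
    rewrite !big_cons big_nil addr0 /L map_mxD; congr (_ + _).
      by apply: map_lin_mx => X; rewrite map_mxM -map_trmx.
    by apply: map_lin_mx => X; rewrite /= map_mxM.
  apply: sum_comm_unitmx => //.
    move=> A B; rewrite !inE => /orP[] /eqP -> /orP[] /eqP ->.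
    - exact: comm_mx_refl.
    - exact: comm_lin_mulmx.
    - exact/comm_mx_sym/comm_lin_mulmx.
    - exact: comm_mx_refl.
  move=> A; rewrite !inE => /orP[] /eqP -> z.
    by move=> /eigenvalue_lin_mulmx; rewrite trmxK; exact: Mh.
  by move=> /eigenvalue_lin_mulmxr; exact: Mh.
exists (vec_mx (mxvec Q *m invmx L)); apply: (can_inj mxvecK).
rewrite -[RHS](mulmxKV Lu) [in RHS]/L mulmxDr linearD /=.
by rewrite -[in RHS](vec_mxK (mxvec Q *m invmx L)) !mul_vec_lin.
Qed.

End Hurwitz.

(** * Dot products and quadratic forms *)

Section Dot.
Variable T : comNzRingType.

Definition dotv n (x y : 'cV[T]_n) : T := (x^T *m y) 0 0.

Lemma dotvE n (x y : 'cV[T]_n) : dotv x y = \sum_i x i 0 * y i 0.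
Proof. by rewrite /dotv mxE; apply: eq_bigr => i _; rewrite mxE. Qed.

Lemma dotvC n (x y : 'cV[T]_n) : dotv x y = dotv y x.
Proof. by rewrite !dotvE; apply: eq_bigr => i _; rewrite mulrC. Qed.

Lemma dotvDr n (x y z : 'cV[T]_n) : dotv x (y + z) = dotv x y + dotv x z.
Proof. by rewrite /dotv mulmxDr mxE. Qed.

Lemma dotvDl n (x y z : 'cV[T]_n) : dotv (y + z) x = dotv y x + dotv z x.
Proof. by rewrite dotvC dotvDr !(dotvC x). Qed.

Lemma dotvZr n a (x y : 'cV[T]_n) : dotv x (a *: y) = a * dotv x y.
Proof. by rewrite /dotv -scalemxAr mxE. Qed.

Lemma dotvZl n a (x y : 'cV[T]_n) : dotv (a *: x) y = a * dotv x y.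
Proof. by rewrite dotvC dotvZr dotvC. Qed.

Lemma dotvNr n (x y : 'cV[T]_n) : dotv x (- y) = - dotv x y.
Proof. by rewrite -scaleN1r dotvZr mulN1r. Qed.

Lemma dotvBr n (x y z : 'cV[T]_n) : dotv x (y - z) = dotv x y - dotv x z.
Proof. by rewrite dotvDr dotvNr. Qed.

Lemma dotv0 n (x : 'cV[T]_n) : dotv x 0 = 0.
Proof. by rewrite /dotv mulmx0 mxE. Qed.

Lemma dotv_mull m n (M : 'M[T]_(m, n)) x y : dotv (M *m x) y = dotv x (M^T *m y).
Proof. by rewrite /dotv trmx_mul mulmxA. Qed.

Lemma dotv_mulr m n (M : 'M[T]_(m, n)) x y : dotv x (M *m y) = dotv (M^T *m x) y.
Proof. by rewrite dotv_mull trmxK. Qed.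

End Dot.

Section RealDot.
Variable R : realFieldType.

Lemma dotvv_ge0 n (x : 'cV[R]_n) : 0 <= dotv x x.
Proof. by rewrite dotvE; apply: sumr_ge0 => i _; rewrite -expr2 sqr_ge0. Qed.

Lemma dotvv_eq0 n (x : 'cV[R]_n) : dotv x x = 0 -> x = 0.
Proof.
rewrite dotvE => /eqP; rewrite psumr_eq0 => [/allP x0|i _]; last first.
  by rewrite -expr2 sqr_ge0.
apply/colP => i; have := x0 i (mem_index_enum i).
by rewrite -expr2 sqrf_eq0 => /eqP ->; rewrite mxE.
Qed.

Lemma dotv_young n (x y : 'cV[R]_n) c : 0 < c ->
  2 * dotv x y <= c * dotv x x + c^-1 * dotv y y.
Proof.
move=> c0; have := dotvv_ge0 (c *: x - y).
rewrite dotvBr !(dotvC (c *: x - y)) !dotvBr !dotvZl !dotvZr.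
rewrite (dotvC y x) => h.
rewrite -(ler_pM2l c0) mulrDr (mulrA c c^-1) divff ?gt_eqF // mul1r.
by nra.
Qed.

Lemma quad_bound n (Q : 'M[R]_n) : exists2 c, 0 <= c &
  forall x, `|dotv x (Q *m x)| <= c * dotv x x.
Proof.
exists (\sum_i \sum_j `|Q i j|) => [|x].
  by apply: sumr_ge0 => i _; apply: sumr_ge0.
rewrite dotvE (le_trans (ler_norm_sum _ _ _)) // mulr_suml.
apply: ler_sum => i _; rewrite mxE mulr_sumr mulr_suml.
rewrite (le_trans (ler_norm_sum _ _ _)) //; apply: ler_sum => j _.
rewrite normrM normrM mulrCA ler_wpM2l //.
(* Since [2 |x_i| |x_j|] is at most [|x_i|^2 + |x_j|^2], and each square is at most [dotv x x],
   every entry of [Q] contributes at most its modulus. *)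
have xi k : `|x k 0| ^+ 2 <= dotv x x.
  rewrite real_normK ?num_real // dotvE (bigD1 k) //= -expr2 lerDl.
  by apply: sumr_ge0 => l _; rewrite -expr2 sqr_ge0.
have := xi i; have := xi j; have := sqr_ge0 (`|x i 0| - `|x j 0|).
by rewrite !expr2; lra.
Qed.

(** If [T *m a] were nonzero, the form would become negative on moving from its zero [a] in the
    direction [- T *m a]. *)
Lemma psd_kernel n (T : 'M[R]_n) (a : 'cV[R]_n) : T^T = T ->
  (forall x, 0 <= dotv x (T *m x)) -> dotv a (T *m a) = 0 -> T *m a = 0.
Proof.
move=> Ts T0 aTa; apply: dotvv_eq0; set b := T *m a.
set e := dotv b (T *m b); have e0 : 0 <= e by exact: T0.
have c0 := dotvv_ge0 b; set c := dotv b b in c0 *.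
have e1 : 0 < 1 + e by lra.
(* At [a - t *: b] the form is [- 2 t c + t^2 e], which for this [t] equals [- (2 + e) t^2]. *)
pose t := c / (1 + e); have := T0 (a - t *: b).
have tE : t * (1 + e) = c by rewrite /t divfK // gt_eqF.
have t0 : 0 <= t by rewrite divr_ge0 // ltW.
rewrite mulmxBr -scalemxAr -/b dotvBr dotvZr 2!(dotvC (a - _)) !dotvBr !dotvZr.
rewrite (dotvC b a) aTa (dotvC _ a) (dotvC _ b) -/e -/c.
rewrite [dotv a (T *m b)]dotv_mulr Ts -/b -/c => h.
have [t00|t0'] := eqVneq t 0; first by rewrite -tE t00 mul0r.
have {}t0 : 0 < t by rewrite lt0r t0'.
by nra.
Qed.

End RealDot.

(** By Cayley-Hamilton the inverse of [g] is a polynomial in [g], so it preserves every subspace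
    that [g] preserves. *)
Lemma unitmx_invariant (F : fieldType) n (g : 'M[F]_n) (K : 'cV[F]_n -> Prop) :
  g \in unitmx -> K 0 -> (forall a x y, K x -> K y -> K (a *: x + y)) ->
  (forall x, K x -> K (g *m x)) -> forall x, K (g *m x) -> K x.
Proof.
(* Polynomials are evaluated in a ring of matrices of positive size; in size 0 all vectors are
   equal. *)
case: n g K => [|n] g K gu K0 Kl Kg x Kgx.
  by have -> : x = g *m x by apply/colP => -[].
have [q qE] : exists q, char_poly g = q * 'X + ((char_poly g)`_0)%:P.
  have /factor_theorem[q qE] : root (char_poly g - ((char_poly g)`_0)%:P) 0.
    by rewrite rootE !hornerE horner_coef0 subrr.
  by exists q; rewrite -[LHS](subrK ((char_poly g)`_0)%:P) qE subr0.
have c0 : (char_poly g)`_0 != 0.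
  by rewrite char_poly_det mulf_neq0 ?signr_eq0 // -unitfE -unitmxE.
have := Cayley_Hamilton g; rewrite {1}qE rmorphD rmorphM /= horner_mx_X horner_mx_C.
move=> /(congr1 (mulmx^~ x)); rewrite mul0mx -mulmxE mulmxDl mul_scalar_mx -mulmxA => h.
have Kq p : K (horner_mx g p *m (g *m x)).
  elim/poly_ind: p => [|p c IH]; first by rewrite rmorph0 mul0mx.
  rewrite rmorphD rmorphM /= horner_mx_X horner_mx_C mulmxDl mul_scalar_mx addrC.
  rewrite -mulmxE; apply: Kl => //; have -> : horner_mx g p *m g = g *m horner_mx g p.
    exact/esym/comm_mx_horner/comm_mx_refl.
  by rewrite -mulmxA; apply: Kg.
have -> : x = (- ((char_poly g)`_0)^-1) *: (horner_mx g q *m (g *m x)) + 0.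
  rewrite addr0; have /eqP := h; rewrite addr_eq0 => /eqP ->.
  by rewrite scalerN scaleNr opprK scalerA mulVf // scale1r.
exact: Kl.
Qed.

(** * Lyapunov and Riccati equations for definite forms *)

Section Riccati.
Variable R : realType.

Lemma map_Re_mul m n p (M : 'M[R]_(m, n)) (X : 'M[R[i]]_(n, p)) :
  map_mx (@complex.Re R) (toC M *m X) = M *m map_mx (@complex.Re R) X.
Proof.
apply/matrixP => i j; rewrite !mxE raddf_sum /=; apply: eq_bigr => k _.
by rewrite !mxE; case: (X k j) => a b /=; rewrite mul0r subr0.
Qed.

Lemma map_Im_mul m n p (M : 'M[R]_(m, n)) (X : 'M[R[i]]_(n, p)) :
  map_mx (@complex.Im R) (toC M *m X) = M *m map_mx (@complex.Im R) X.
Proof.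
apply/matrixP => i j; rewrite !mxE raddf_sum /=; apply: eq_bigr => k _.
by rewrite !mxE; case: (X k j) => a b /=; rewrite mul0r addr0.
Qed.

(** A nonzero [T] would yield an eigenvalue of [M] on the quotient by the kernel of [T]. Its real
    part is negative because [M] is Hurwitz, whereas the equation makes the form of [T *m M]
    nonnegative. *)
Lemma lyapunov_psd_eq0 n m (T M : 'M[R]_n) (B : 'M[R]_(n, m)) :
  T^T = T -> (forall x, 0 <= dotv x (T *m x)) -> hurwitz M ->
  M^T *m T + T *m M = T *m B *m B^T *m T -> T = 0.
Proof.
move=> Ts T0 Mh TM; apply/eqP; apply: contraT => Tn0.
(* The relation [T *m M = N *m T] makes the range of [T] stable under [N], which therefore has an
   eigenvector there. *)
pose N := T *m B *m B^T - M^T.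
have TMN : T *m M = N *m T.
  by rewrite mulmxBl -TM addrC addKr.
have TCs : (toC T)^T = toC T by rewrite /toC map_trmx Ts.
have [] := @common_eigenvector_in _ _ (toC T) [:: (toC N)^T].
- by rewrite map_mx_eq0.
- move=> _ /[!inE] /eqP ->; have : (toC N *m toC T)^T = (toC T *m toC M)^T.
    by rewrite -!map_mxM TMN.
  rewrite !trmx_mul TCs => ->; exact: submxMl.
- by move=> _ _ /[!inE] /eqP -> /eqP ->; exact: comm_mx_refl.
move=> u [u0 /submxP[y yE] us].
have /sub_rVP[l lE] := us _ (mem_head _ _).
pose x := y^T; have uE : u^T = toC T *m x.
  by rewrite yE trmx_mul TCs.
have xE : toC T *m (toC M *m x) = l *: (toC T *m x).
  rewrite mulmxA -map_mxM TMN map_mxM -mulmxA -[X in _ *m X]uE.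
  by rewrite -[_ *m u^T]trmxK trmx_mul trmxK lE linearZ /= uE.
(* If [M - l] were invertible, the kernel of [T], which it preserves and which contains the image of
   [x], would contain [x] itself. *)
have leig : eigenvalue (toC M) l.
  rewrite eigenvalue_unitmx; apply/negP => gu.
  have TCM z : toC T *m (toC M *m z) = toC N *m (toC T *m z).
    by rewrite !mulmxA -!map_mxM TMN.
  have : toC T *m x = 0.
    apply: (unitmx_invariant gu (K := fun z => toC T *m z = 0)).
    - exact: mulmx0.
    - by move=> a z w z0 w0; rewrite mulmxDr -scalemxAr z0 w0 scaler0 addr0.
    - move=> z z0; rewrite mulmxBl mulmxBr TCM z0 mulmx0.
      by rewrite mul_scalar_mx -scalemxAr z0 scaler0 subr0.
    by rewrite mulmxBl mulmxBr xE mul_scalar_mx -scalemxAr subrr.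
  by rewrite -uE => /(congr1 trmx); rewrite trmxK trmx0; exact/eqP.
have lneg := Mh _ leig.
pose a := map_mx (@complex.Re R) x; pose b := map_mx (@complex.Im R) x.
case: l => al be in lE xE leig lneg; rewrite /= in lneg.
have aE : T *m (M *m a) = al *: (T *m a) - be *: (T *m b).
  rewrite /a /b -!map_Re_mul -map_Im_mul xE; apply/matrixP => i j; rewrite !mxE.
  by case: (\sum_ _ _).
have bE : T *m (M *m b) = al *: (T *m b) + be *: (T *m a).
  rewrite /a /b -!map_Im_mul -map_Re_mul xE; apply/matrixP => i j; rewrite !mxE.
  by case: (\sum_ _ _) => ? ? /=; rewrite addrC.
have TMpos z : 0 <= dotv z (T *m (M *m z)).
  have : dotv z (M^T *m T *m z + T *m M *m z) = dotv (B^T *m T *m z) (B^T *m T *m z).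
    by rewrite -mulmxDl TM dotv_mull trmx_mul trmxK Ts !mulmxA.
  rewrite dotvDr -!mulmxA -[dotv z (M^T *m _)]dotv_mull (dotvC (M *m z)).
  rewrite dotv_mull Ts => h.
  by have := dotvv_ge0 (B^T *m (T *m z)); rewrite -h; lra.
have ab : dotv a (T *m b) = dotv b (T *m a) by rewrite dotv_mulr Ts dotvC.
have ha := TMpos a; have hb := TMpos b.
(* In the sum of these two inequalities the terms in [be] cancel, leaving [al] times a sum of two
   nonnegative values; as [al] is negative, both values vanish. *)
rewrite aE dotvBr !dotvZr in ha; rewrite bE dotvDr !dotvZr in hb.
have Ta0 := T0 a; have Tb0 := T0 b; rewrite ab in ha.
have a0 : dotv a (T *m a) = 0 by nra.
have b0 : dotv b (T *m b) = 0 by nra.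
have /eqP[] := u0; apply: trmx_inj; rewrite uE trmx0.
have TR : map_mx (@complex.Re R) (toC T *m x) = 0 by rewrite map_Re_mul psd_kernel.
have TI : map_mx (@complex.Im R) (toC T *m x) = 0 by rewrite map_Im_mul psd_kernel.
apply/matrixP => i j; move/matrixP: TR => /(_ i j); move/matrixP: TI => /(_ i j).
rewrite !mxE; move: (\sum_ _ _) => [r s] /= -> ->; reflexivity.
Qed.

(** Along [M] the form [D] has derivative [dotv y y] with [y = B^T *m (D *m x)], and [- S] has
    derivative [dotv x x - dotv y (G *m x)]. A large multiple of [D] absorbs the cross term. *)
Lemma chetaev_form n m (A D : 'M[R]_n) (B : 'M[R]_(n, m)) x0 :
  hurwitz (- A) -> D^T = D -> A^T *m D + D *m A = D *m B *m B^T *m D ->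
  0 < dotv x0 (D *m x0) ->
  let M := B *m B^T *m D - A in
  exists H, 0 < dotv x0 (H *m x0) /\
    forall x, 2^-1 * dotv x x <= dotv (M *m x) (H *m x) + dotv x (H *m (M *m x)).
Proof.
move=> Ah Ds AD x0D M; have [S SE] := lyapunov_solution (- 1%:M) Ah.
pose G := B^T *m (S + S^T).
have [c c0 cG] := quad_bound (G^T *m G).
set d0 := dotv x0 _ in x0D; set s0 := dotv x0 (S *m x0).
(* The first summand dominates the cross term after Young's inequality with constant [1 + c]; the
   second keeps the form positive at [x0]. *)
pose K := (1 + c) / 2 + (`|s0| + 1) / d0.
exists (K *: D - S); split.
  rewrite mulmxBl dotvBr -scalemxAl dotvZr -/d0 -/s0 /K mulrDl divfK ?gt_eqF //.
  have := ler_norm s0; have : 0 <= (1 + c) / 2 * d0 by apply: mulr_ge0; lra.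
  by lra.
move=> x; pose y := B^T *m (D *m x).
have K1 : (1 + c) / 2 <= K.
  by rewrite /K lerDl divr_ge0 ?addr_ge0 // ltW.
have MD : dotv (M *m x) (D *m x) + dotv x (D *m (M *m x)) = dotv y y.
  have -> : dotv (M *m x) (D *m x) = dotv x (D *m (M *m x)).
    by rewrite dotvC dotv_mull Ds.
  have := congr1 (fun Z => dotv x (Z *m x)) AD.
  rewrite /= mulmxDl dotvDr -!mulmxA dotv_mulr trmxK dotvC.
  rewrite dotv_mull Ds => E1.
  rewrite mulmxBl mulmxBr dotvBr -!mulmxA.
  have E2 : dotv x (D *m (B *m (B^T *m (D *m x)))) = dotv y y.
    by rewrite /y dotv_mulr Ds dotv_mulr.
  by rewrite E2 in E1 *; lra.
have MS : dotv (M *m x) (S *m x) + dotv x (S *m (M *m x)) = - dotv x x + dotv y (G *m x).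
  have := congr1 (fun Z => dotv x (Z *m x)) SE.
  rewrite /= mulmxDl dotvDr -!mulmxA [dotv x ((- A)^T *m _)]dotv_mulr trmxK.
  rewrite !mulNmx mul1mx mulmxN !dotvNr dotvC dotvNr => E1.
  rewrite mulmxBl mulmxBr dotvBr dotvC dotvBr.
  have E2 : dotv y (B^T *m ((S + S^T) *m x)) = dotv (S *m x) (B *m B^T *m D *m x) +
      dotv x (S *m (B *m B^T *m D *m x)).
    rewrite -!mulmxA -/y mulmxDl mulmxDr dotvDr dotv_mulr trmxK dotvC.
    congr (_ + _); rewrite dotv_mulr trmxK dotv_mulr trmxK dotvC.
    by [].
  by rewrite E2; lra.
have -> : dotv (M *m x) ((K *: D - S) *m x) + dotv x ((K *: D - S) *m (M *m x)) =
   K * (dotv (M *m x) (D *m x) + dotv x (D *m (M *m x))) -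
   (dotv (M *m x) (S *m x) + dotv x (S *m (M *m x))).
  by rewrite !mulmxBl !dotvBr -!scalemxAl !dotvZr; lra.
rewrite MD MS; have c1 : 0 < 1 + c by lra.
have := dotv_young y (G *m x) c1.
have : (1 + c)^-1 * dotv (G *m x) (G *m x) <= dotv x x.
  rewrite mulrC ler_pdivrMr // dotv_mull mulmxA.
  have := cG x; have := dotvv_ge0 x; have := ler_norm (dotv x (G^T *m G *m x)); lra.
have := dotvv_ge0 y; have := dotvv_ge0 x; nra.
Qed.

End Riccati.

(** * Taylor expansions along lines *)

Section OneVariable.
Variable R : realType.
Implicit Types (f g : R -> R) (p : {poly R}) (N : nat).

(** The intermediate point is kept away from 0, where [bigO_pow] gives no bound. *)
Lemma MVT_center f df (d t : R) :
  (forall s : R, `|s| < d -> is_derive s (1 : R) f (df s)) -> 0 < `|t| -> `|t| < d ->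
  exists s, [/\ 0 < `|s|, `|s| <= `|t| & f t - f 0 = df s * t].
Proof.
move=> fd t0 td.
have fc a b : (forall s, s \in `[a, b] -> `|s| < d) -> {within `[a, b], continuous f}.
  move=> ab; apply: derivable_within_continuous => s sab.
  by have [] := fd s (ab s sab).
have [tneg|tpos|t00] := ltgtP t 0; last by rewrite t00 normr0 ltxx in t0.
- have tn : `|t| = - t by rewrite ltr0_norm.
  have td' s : s \in `[t, 0] -> `|s| < d.
    by rewrite in_itv /= => /andP[s0 s1]; rewrite ler0_norm //; lra.
  have [s] := MVT tneg (fun s st => fd s (td' s (subset_itv_oo_cc st))) (fc t 0 td').
  rewrite in_itv /= => /andP[s0 s1] E; exists s.
  rewrite ltr0_norm // tn; split; [lra|lra|].
  by rewrite -opprB E sub0r mulrN opprK.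
have tn : `|t| = t by rewrite gtr0_norm.
have td' s : s \in `[0, t] -> `|s| < d.
  by rewrite in_itv /= => /andP[s0 s1]; rewrite ger0_norm //; lra.
have [s] := MVT tpos (fun s st => fd s (td' s (subset_itv_oo_cc st))) (fc 0 t td').
rewrite in_itv /= subr0 => /andP[s0 s1] E; exists s.
by rewrite gtr0_norm // tn; split=> //; lra.
Qed.

(** The usual [O(t^N)] at 0, on a punctured neighbourhood so that factors [t] can be cancelled. *)
Definition bigO_pow N f := exists c d : R, [/\ 0 <= c, 0 < d &
  forall t, 0 < `|t| -> `|t| < d -> `|f t| <= c * `|t| ^+ N].

Lemma bigO_pow_ext N f g : bigO_pow N f -> f =1 g -> bigO_pow N g.
Proof.
by move=> [c [d [c0 d0 fN]]] fg; exists c, d; split=> // t t0 td; rewrite -fg fN.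
Qed.

Lemma bigO_pow_near N f g d : bigO_pow N f -> 0 < d ->
  (forall t, `|t| < d -> f t = g t) -> bigO_pow N g.
Proof.
move=> [c [e [c0 e0 fN]]] d0 fg; exists c, (Num.min d e); split=> //.
  by rewrite lt_min d0.
by move=> t t0; rewrite lt_min => /andP[td te]; rewrite -fg // fN.
Qed.

Lemma bigO_powD N f g : bigO_pow N f -> bigO_pow N g -> bigO_pow N (fun t => f t + g t).
Proof.
move=> [c [e [c0 e0 fN]]] [c' [e' [c0' e0' gN]]].
exists (c + c'), (Num.min e e'); split; rewrite ?addr_ge0 ?lt_min ?e0 //.
move=> t t0; rewrite lt_min => /andP[te te'].
by rewrite (le_trans (ler_normD _ _)) // mulrDl lerD ?fN ?gN.
Qed.

Lemma bigO_powM N M f g : bigO_pow N f -> bigO_pow M g -> bigO_pow (N + M) (fun t => f t * g t).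
Proof.
move=> [c [e [c0 e0 fN]]] [c' [e' [c0' e0' gN]]].
exists (c * c'), (Num.min e e'); split; rewrite ?mulr_ge0 ?lt_min ?e0 //.
move=> t t0; rewrite lt_min => /andP[te te'].
by rewrite normrM exprD mulrACA ler_pM ?fN ?gN.
Qed.

Lemma bigO_pow_le N M f : (N <= M)%N -> bigO_pow M f -> bigO_pow N f.
Proof.
move=> NM [c [e [c0 e0 fN]]]; exists c, (Num.min e 1); split=> //.
  by rewrite lt_min e0 ltr01.
move=> t t0; rewrite lt_min => /andP[te t1].
by rewrite (le_trans (fN t t0 te)) // ler_wpM2l // ler_wiXn2l // ltW.
Qed.

Lemma bigO_pow_cst a : bigO_pow 0 (fun=> a).
Proof. by exists `|a|, 1; split=> // t _ _; rewrite expr0 mulr1. Qed.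

Lemma bigO_powZ a N f : bigO_pow N f -> bigO_pow N (fun t => a * f t).
Proof. by move=> fN; rewrite -[N]add0n; apply: bigO_powM => //; exact: bigO_pow_cst. Qed.

Lemma bigO_pow_sum I (r : seq I) (P : pred I) (F : I -> R -> R) N :
  (forall i, P i -> bigO_pow N (F i)) -> bigO_pow N (fun t => \sum_(i <- r | P i) F i t).
Proof.
move=> FN; elim: r => [|i r IH].
  by exists 0, 1; split=> // t _ _; rewrite big_nil normr0 mul0r.
have [Pi|nPi] := boolP (P i).
  by apply: bigO_pow_ext (bigO_powD (FN i Pi) IH) _ => t; rewrite big_cons Pi.
by apply: bigO_pow_ext IH _ => t; rewrite big_cons (negbTE nPi).
Qed.

Lemma bigO_pow_id N : bigO_pow N (fun t => t ^+ N).
Proof. by exists 1, 1; split=> // t _ _; rewrite mul1r normrX. Qed.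

Lemma bigO_pow_horner p : bigO_pow 0 (horner p).
Proof.
elim/poly_ind: p => [|p c IH].
  by apply: bigO_pow_ext (bigO_pow_cst 0) _ => t; rewrite horner0.
apply: bigO_pow_ext (bigO_powD (bigO_pow_le (leq0n 1) (bigO_powM IH (bigO_pow_id 1))) (bigO_pow_cst c)) _.
by move=> t; rewrite !hornerE.
Qed.

Lemma poly_factorX (F : idomainType) (p : {poly F}) :
  exists q, p = q * 'X + (p`_0)%:P.
Proof.
have /factor_theorem[q qE] : root (p - (p`_0)%:P) 0.
  by rewrite rootE !hornerE horner_coef0 subrr.
by exists q; rewrite -[LHS](subrK (p`_0)%:P) qE subr0.
Qed.

Lemma bigO_pow_coef0 p : bigO_pow 1 (horner p) -> p`_0 = 0.
Proof.
move=> pN; have [q pE] := poly_factorX p.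
have : bigO_pow 1 (fun=> p`_0).
  apply: bigO_pow_ext (bigO_powD pN (bigO_powZ (-1) (bigO_powM (bigO_pow_horner q) (bigO_pow_id 1)))) _.
  by move=> t; rewrite /= {1}pE hornerMXaddC expr1; ring.
move=> [c [d [c0 d0 h]]]; apply/eqP; apply: contraT => p0.
have a0 : 0 < `|p`_0| by rewrite normr_gt0.
set a := `|p`_0| in a0 h.
(* For this [t] one has [2 (c + 1) t <= a], against the bound [a <= c t]. *)
pose t := Num.min (d / 2) (a / (2 * (c + 1))).
have c1 : 0 < 2 * (c + 1) by lra.
have t0 : 0 < t by rewrite /t lt_min !divr_gt0.
have td : t < d by rewrite /t gt_min; apply/orP; left; lra.
have ta : t * (2 * (c + 1)) <= a by rewrite -ler_pdivlMr // /t ge_min lexx orbT.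
have := h t; rewrite gtr0_norm // expr1 => /(_ t0 td) act.
by exfalso; have := mulr_ge0 c0 (ltW t0); clear - act t0 ta; nra.
Qed.

(** The constant coefficient vanishes; dividing by [t] then lowers the order by one. This converts
    asymptotic identities into identities between coefficients. *)
Lemma bigO_pow_coef p N : bigO_pow N (horner p) -> forall k, (k < N)%N -> p`_k = 0.
Proof.
elim: N p => [//|N IH] p pN k kN.
have p0 : p`_0 = 0 by apply/bigO_pow_coef0/(bigO_pow_le _ pN).
case: k kN => [//|k]; rewrite ltnS => kN.
have [q pE] := poly_factorX p; rewrite p0 addr0 in pE.
rewrite pE coefMX /=; apply: IH => //.
have [c [d [c0 d0 h]]] := pN; exists c, d; split=> // t t0 td.
have := h t t0 td; rewrite pE !hornerE normrM exprSr mulrA.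
by rewrite ler_pM2r.
Qed.

(** The derivative of the remainder is the remainder of the shifted sequence, one order lower; the
    mean value theorem recovers the missing factor [t]. *)
Lemma taylor_bigO_pow N (g : nat -> R -> R) d : 0 < d ->
  (forall j t, (j <= N)%N -> `|t| < d -> is_derive t (1 : R) (g j) (g j.+1 t)) ->
  bigO_pow N (fun t => g 0%N t - (\poly_(j < N) (g j 0 / (j`!)%:R)).[t]).
Proof.
move=> d0; elim: N g => [|N IH] g gd.
  have : differentiable (g 0%N) 0.
    have d00 : `|0 : R| < d by rewrite normr0.
    by apply/derivable1_diffP; have [] := gd 0%N 0 isT d00.
  move=> /differentiable_continuous /cvgrPdist_lt /(_ 1 ltr01) /nbhs_ballP[e /= e0 he].
  exists (`|g 0%N 0| + 1), e; split=> //.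
  move=> t t0 te; rewrite poly_def big_ord0 horner0 subr0 expr0 mulr1.
  have := he t; rewrite /ball /= sub0r normrN => /(_ te).
  have := ler_distD (g 0%N 0) (g 0%N t) 0; rewrite !subr0 distrC; lra.
have [c [e [c0 e0 h]]] := IH (fun j => g j.+1) (fun j t jN => gd j.+1 t jN).
exists c, (Num.min d e); split=> //; first by rewrite lt_min d0.
move=> t t0; rewrite lt_min => /andP[td te].
set p := \poly_(j < N.+1) _.
have pd : p^`() = \poly_(j < N) (g j.+1 0 / (j`!)%:R).
  apply/polyP => j; rewrite coef_deriv !coef_poly ltnS.
  case: ifP => jN; last by rewrite mul0rn.
  rewrite -mulr_natl factS natrM; field.
  by rewrite nat1r !pnatr_eq0 -lt0n fact_gt0.
have hd s : `|s| < d -> is_derive s (1 : R) (fun t => g 0%N t - p.[t]) (g 1%N s - p^`().[s]).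
  by move=> sd; have := gd 0%N s isT sd => ?; apply: is_deriveB.
have [s [s0 st E]] := MVT_center hd t0 td.
have h0 : g 0%N 0 - p.[0] = 0.
  by rewrite horner_coef0 coef_poly /= fact0 divr1 subrr.
rewrite h0 subr0 in E; rewrite E normrM exprSr mulrA ler_wpM2r // pd.
rewrite (le_trans (h s s0 (le_lt_trans st te))) // ler_wpM2l //.
by rewrite lerXn2r // nnegrE.
Qed.

End OneVariable.

(** * Symmetry of second directional derivatives *)

Section Differential.
Variable R : realType.
Variable V : normedModType R.
Implicit Types (f : V -> R) (a u w x : V).

Lemma is_derive_line f a x (t : R) : derivable f (a + t *: x) x ->
  is_derive t (1 : R) (fun s => f (a + s *: x)) ('D_x f (a + t *: x)).
Proof.
move=> fd.
have E : (fun h : R => h^-1 *: (f (a + (h *: (1 : R) + t) *: x) - f (a + t *: x))) =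
         (fun h : R => h^-1 *: (f (h *: x + (a + t *: x)) - f (a + t *: x))).
  apply/funext => h; congr (_ *: (f _ - _)).
  by rewrite [h *: 1]mulr1 scalerDl addrCA.
by apply: DeriveDef; rewrite /derivable /derive /= E.
Qed.

Lemma differentiable_eps f a : differentiable f a -> forall e, 0 < e ->
  exists2 d, 0 < d & forall y, `|y| < d ->
    `|f (a + y) - f a - 'D_y f a| <= e * `|y|.
Proof.
move=> fd e e0; have /eqaddoP /(_ e e0) := diff_locally fd.
move=> /nbhs_ballP[d /= d0 h]; exists d => // y yd.
have := h y; rewrite -ball_normE /= sub0r normrN deriveE // => /(_ yd).
by rewrite !fctE /= /shift /= [y + a]addrC opprD addrA.
Qed.

(** The double difference is an increment of [s |-> f (a + h w + s u) - f (a + s u)]. The mean value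
    theorem reduces it to values of ['D_u f], expanded to first order at [a]. *)
Lemma second_difference f a u w (U : set V) : open U -> U a ->
  (forall x, U x -> differentiable f x) -> differentiable ('D_u f) a ->
  forall e, 0 < e -> exists2 d, 0 < d & forall h : R, 0 < `|h| -> `|h| < d ->
    `|f (a + h *: w + h *: u) - f (a + h *: u) - f (a + h *: w) + f a
      - h ^+ 2 * 'D_w ('D_u f) a| <= e * h ^+ 2.
Proof.
(* [k] dominates [(|h w + s u| + |s u|) / |h|] for [|s| <= |h|], the sum of the two expansion errors
   relative to [h]. *)
move=> Uo Ua fd ud e e0; pose k := 1 + 2 * `|u| + `|w|.
have k0 : 0 < k by rewrite /k; have := normr_ge0 u; have := normr_ge0 w; lra.
have [d d0 hd] := differentiable_eps ud (divr_gt0 e0 k0).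
have /nbhs_ballP[r /= r0 hr] : nbhs a U by exact: open_nbhs_nbhs.
pose m := Num.min d r; have m0 : 0 < m by rewrite lt_min d0.
exists (m / k); first exact: divr_gt0.
move=> h h0; rewrite ltr_pdivlMr // => hm.
have small (s b : R) : `|s| <= 2 * `|h| -> b = 0 \/ b = h -> `|b *: w + s *: u| < m.
  move=> sh bh; rewrite (le_lt_trans (ler_normD _ _)) // !normrZ.
  rewrite (le_lt_trans _ hm) // /k.
  have : `|s| * `|u| <= 2 * `|h| * `|u| by rewrite ler_wpM2r.
  have : `|b| * `|w| <= `|h| * `|w|.
    by rewrite ler_wpM2r //; case: bh => ->; rewrite ?normr0.
  have := mulr_ge0 (normr_ge0 h) (normr_ge0 u); lra.
have smallE y : `|y| < m -> U (a + y) /\ `|y| < d.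
  rewrite lt_min => /andP[-> yr]; split=> //; apply: hr.
  by rewrite -ball_normE /= opprD addNKr normrN.
pose phi b (s : R) := f (a + b *: w + s *: u).
have der (b s : R) : b = 0 \/ b = h -> `|s| < 2 * `|h| ->
    is_derive s (1 : R) (phi b) ('D_u f (a + (b *: w + s *: u))).
  move=> bh sh; rewrite addrA; apply/is_derive_line/diff_derivable/fd.
  by rewrite -addrA; have [] := smallE _ (small s b (ltW sh) bh).
have derB (s : R) : `|s| < 2 * `|h| -> is_derive s (1 : R) (fun s => phi h s - phi 0 s)
    ('D_u f (a + (h *: w + s *: u)) - 'D_u f (a + (0 *: w + s *: u))).
  by move=> sh; apply: is_deriveB; apply: der => //; [right|left].
(* The radius [2 * |h|] leaves the end point [h] strictly inside. *)
have [|s [s0 sh E]] := MVT_center derB h0; first by lra.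
have hds b : b = 0 \/ b = h -> `|b *: w + s *: u| < d.
  move=> bh; have sh2 : `|s| <= 2 * `|h| by lra.
  by have [] := smallE _ (small s b sh2 bh).
have L (y : V) : 'D_y ('D_u f) a = 'd ('D_u f) a y by rewrite deriveE.
have H1 := hd _ (hds h (or_intror erefl)); have H0 := hd _ (hds 0 (or_introl erefl)).
have LL (b : R) : 'd ('D_u f) a (b *: w + s *: u) =
    b * 'd ('D_u f) a w + s * 'd ('D_u f) a u by rewrite linearD !linearZ.
rewrite !L !LL mul0r add0r in H1 H0.
rewrite !L.
have -> : f (a + h *: w + h *: u) - f (a + h *: u) - f (a + h *: w) + f a =
   (phi h h - phi 0 h) - (phi h 0 - phi 0 0).
  by rewrite /phi !scale0r !addr0 opprB addrA addrAC.
rewrite E; move: H1 H0.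
set X1 : R := 'D_u f (a + (h *: w + s *: u)).
set X0 : R := 'D_u f (a + (0 *: w + s *: u)).
set dw : R := 'd ('D_u f) a w; set du : R := 'd ('D_u f) a u.
set F0 : R := 'D_u f a => H1 H0.
have -> : (X1 - X0) * h - h ^+ 2 * dw = h * ((X1 - F0 - (h * dw + s * du)) - (X0 - F0 - s * du)).
  by ring.
rewrite normrM -real_normK ?num_real // expr2 [e * _]mulrCA ler_wpM2l //.
rewrite (le_trans (ler_normB _ _)) // (le_trans (lerD H1 H0)) //.
rewrite -mulrDr -mulrA ler_wpM2l ?(ltW e0) // [k^-1 * _]mulrC ler_pdivrMr //.
have := ler_normD (h *: w) (s *: u); rewrite scale0r add0r !normrZ => nw.
have : `|s| * `|u| <= `|h| * `|u| by rewrite ler_wpM2r.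
by rewrite /k; have := normr_ge0 h; lra.
Qed.

(** The double difference is symmetric in [u] and [w], so both mixed derivatives are its limit after
    division by [h ^+ 2]. *)
Lemma derive_comm f a u w (U : set V) : open U -> U a ->
  (forall x, U x -> differentiable f x) ->
  differentiable ('D_u f) a -> differentiable ('D_w f) a ->
  'D_w ('D_u f) a = 'D_u ('D_w f) a.
Proof.
move=> Uo Ua fd ud wd; apply/eqP; rewrite -subr_eq0 -normr_le0; apply/ler_addgt0Pl.
move=> e e0; rewrite addr0.
have e2 : 0 < e / 2 by lra.
have [d d0 hd] := second_difference w Uo Ua fd ud e2.
have [d' d0' hd'] := second_difference u Uo Ua fd wd e2.
pose h := Num.min d d' / 2; have h0 : 0 < h by rewrite divr_gt0 // lt_min d0.
have hdd : h < Num.min d d' by rewrite /h in h0 *; lra.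
have := hdd; rewrite lt_min => /andP[h1 h2].
have := hd h; have := hd' h; rewrite gtr0_norm // => /(_ h0 h2) H2 /(_ h0 h1) H1.
rewrite -(ler_pM2l (exprn_gt0 2 h0)) -[X in X * _ <= _](@ger0_norm _ (h ^+ 2)) ?sqr_ge0 //.
rewrite -normrM mulrBr.
move: H1 H2; rewrite [a + h *: u + h *: w]addrAC.
rewrite [_ - f (a + h *: w) - f (a + h *: u)]addrAC.
set p : R := 'D_w ('D_u f) a; set q : R := 'D_u ('D_w f) a.
set D : R := _ + f a => H1 H2.
have -> : h ^+ 2 * p - h ^+ 2 * q = (D - h ^+ 2 * q) - (D - h ^+ 2 * p).
  by rewrite opprB [RHS]addrC addrA subrK.
apply: le_trans (ler_normB _ _) _; apply: le_trans (lerD H2 H1) _.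
by rewrite -mulrDl -splitr mulrC.
Qed.

End Differential.

(* Locked: otherwise unification unfolds the limits hidden in ['D_v]. *)
HB.lock Definition deriven (R : realType) n (v : 'cV[R]_n) m (f : 'cV[R]_n -> R) :=
  iter m (fun g => 'D_v g) f.

(** * Iterated directional derivatives of smooth functions *)

Section Smooth.
Variable R : realType.

Lemma near_eq_differentiable (V W : normedModType R) (f g : V -> W) x :
  (\forall y \near x, f y = g y) -> differentiable f x -> differentiable g x.
Proof.
move=> fg fd; have fgx : f x = g x := nbhs_singleton fg.
have gE : g \o shift x = cst (g x) + 'd f x +o_ (0 : V) id.
  apply/eqaddoP => e e0; have /eqaddoP /(_ e e0) h := diff_locally fd.
  have fg0 : \forall y \near (0 : V), f (y + x) = g (y + x).
    by move: fg; rewrite (near_shift 0) subr0.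
  by apply: filterS2 h fg0 => y; rewrite !fctE /= /shift => h <-; rewrite -fgx.
have [dc _] := (@diff_locallyP _ _ _ x f).1 fd.
by apply/diff_locallyP; rewrite (diff_unique dc gE).
Qed.

Variable n : nat.
Variable U : set 'cV[R]_n.
Hypothesis Uo : open U.
Implicit Types (f g : 'cV[R]_n -> R) (x v w : 'cV[R]_n).

Record smooth_on f : Prop := SmoothOn { smooth_class : forall k, class_C k U f }.

Lemma near_in x f g : U x -> (forall y, U y -> f y = g y) ->
  \forall y \near x, f y = g y.
Proof.
move=> Ux fg; have : nbhs x U by exact: open_nbhs_nbhs.
exact: filterS.
Qed.

Lemma derive_eq_on f g v x : (forall y, U y -> f y = g y) -> U x ->
  'D_v f x = 'D_v g x.
Proof. by move=> fg Ux; apply/near_eq_derive/near_in. Qed.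

Lemma class_C_eq k f g : (forall y, U y -> f y = g y) ->
  class_C k U f -> class_C k U g.
Proof.
elim: k f g => [|k IH] f g fg /=.
  move=> fc x Ux; rewrite /prop_for /continuous_at -fg //.
  apply: cvg_trans; last exact: fc.
  exact: (near_eq_cvg (near_in Ux fg)).
move=> [fd fC]; split=> [x Ux|i].
  exact: near_eq_differentiable (near_in Ux fg) (fd x Ux).
by apply: IH (fC i) => y Uy; exact: derive_eq_on.
Qed.

Lemma class_C_lin k a f g : class_C k U f -> class_C k U g ->
  class_C k U (fun x => f x + a * g x).
Proof.
elim: k f g => [|k IH] f g /=.
  move=> fc gc x Ux; apply: (@continuousD _ _ _ f (fun x => a * g x)); first exact: fc.
  by apply: (@continuousM _ _ (fun=> a) g); [exact: cst_continuous|exact: gc].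
move=> [fd fC] [gd gC].
have ad x : U x -> differentiable (fun x => a * g x) x.
  by move=> Ux; apply: (@differentiableZ _ _ _ g a); exact: gd.
split=> [x Ux|i].
  by apply: (@differentiableD _ _ _ f (fun x => a * g x)); [exact: fd|exact: ad].
apply: (@class_C_eq k (fun x => 'D_(delta_mx i 0) f x + a * 'D_(delta_mx i 0) g x)).
  move=> x Ux; have fx := @diff_derivable _ _ _ _ _ (delta_mx i 0 : 'cV[R]_n) (fd x Ux).
  have gx := @diff_derivable _ _ _ _ _ (delta_mx i 0 : 'cV[R]_n) (gd x Ux).
  have ax := @diff_derivable _ _ _ _ _ (delta_mx i 0 : 'cV[R]_n) (ad x Ux).
  rewrite (deriveD fx ax); congr (_ + _).
  by rewrite (deriveZ a gx).
exact: IH.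
Qed.

Lemma smooth_diff f x : smooth_on f -> U x -> differentiable f x.
Proof. by move=> fs Ux; have [fd _] := smooth_class fs 1%N; exact: fd. Qed.

Lemma smooth_lin a f g : smooth_on f -> smooth_on g ->
  smooth_on (fun x => f x + a * g x).
Proof. by move=> [fs] [gs]; split=> k; exact: class_C_lin. Qed.

Lemma smooth_eq f g : (forall y, U y -> f y = g y) -> smooth_on f -> smooth_on g.
Proof. by move=> fg [fs]; split=> k; exact: class_C_eq (fs k). Qed.

Lemma smooth0 : smooth_on (fun=> 0).
Proof.
split; elim=> [|k IH] /=; first by move=> x _; exact: cst_continuous.
split=> [x _|i]; first exact: differentiable_cst.
by apply: class_C_eq IH => y _; rewrite derive_cst.
Qed.

Lemma derive_sum_delta f x v : differentiable f x ->
  'D_v f x = \sum_i v i 0 * 'D_(delta_mx i 0) f x.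
Proof.
move=> fd; rewrite deriveE // {1}[v]matrix_sum_delta linear_sum.
apply: eq_bigr => i _; rewrite big_ord1 linearZ deriveE //.
Qed.

(** [class_C] speaks of coordinate directions only; any other derivative is a linear combination of
    those. *)
Lemma smooth_derive f v : smooth_on f -> smooth_on ('D_v f).
Proof.
move=> fs; apply: (@smooth_eq (fun x => \sum_i v i 0 * 'D_(delta_mx i 0) f x)).
  by move=> x Ux; rewrite -derive_sum_delta //; exact: smooth_diff.
suff H (r : seq 'I_n) :
    smooth_on (fun x => \sum_(i <- r) v i 0 * 'D_(delta_mx i 0) f x) by exact: H.
elim: r => [|i r IH].
  by apply: smooth_eq smooth0 => y _; rewrite big_nil.
have fi : smooth_on ('D_(delta_mx i 0) f) by split=> k; have [_] := smooth_class fs k.+1; exact.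
by apply: smooth_eq (smooth_lin (v i 0) IH fi) => y _; rewrite big_cons addrC.
Qed.

Lemma deriven0 v f : deriven v 0 f = f.
Proof. by rewrite deriven.unlock. Qed.

Lemma derivenS v m f : deriven v m.+1 f = 'D_v (deriven v m f).
Proof. by rewrite deriven.unlock. Qed.

Lemma derivenSr v m f : deriven v m.+1 f = deriven v m ('D_v f).
Proof. by rewrite deriven.unlock iterSr. Qed.

Lemma smooth_deriven v m f : smooth_on f -> smooth_on (deriven v m f).
Proof. by move=> fs; elim: m => [|m IH]; rewrite ?deriven0 ?derivenS //; exact: smooth_derive. Qed.

Lemma deriven_eq v m f g x : (forall y, U y -> f y = g y) -> U x ->
  deriven v m f x = deriven v m g x.
Proof.
move=> fg; elim: m x => [|m IH] x Ux; first by rewrite !deriven0 fg.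
by rewrite !derivenS; exact: derive_eq_on.
Qed.

Lemma derive_lin v a f g x : smooth_on f -> smooth_on g -> U x ->
  'D_v (fun x => f x + a * g x) x = 'D_v f x + a * 'D_v g x.
Proof.
move=> fs gs Ux; have fx := @diff_derivable _ _ _ _ _ v (smooth_diff fs Ux).
have gx := @diff_derivable _ _ _ _ _ v (smooth_diff gs Ux).
have ax : derivable (fun x => a * g x) x v by exact: (@derivableZ _ _ _ g a).
by rewrite (deriveD fx ax); congr (_ + _); rewrite (deriveZ a gx).
Qed.

Lemma deriven_lin v m a f g x : smooth_on f -> smooth_on g -> U x ->
  deriven v m (fun x => f x + a * g x) x = deriven v m f x + a * deriven v m g x.
Proof.
move=> fs gs; elim: m x => [|m IH] x Ux; first by rewrite !deriven0.
by rewrite !derivenS (derive_eq_on _ IH) // derive_lin //; exact: smooth_deriven.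
Qed.

Lemma derive_dir f x v w s : differentiable f x ->
  'D_(v + s *: w) f x = 'D_v f x + s * 'D_w f x.
Proof. by move=> fd; rewrite !deriveE // linearD linearZ. Qed.

Lemma deriveC_on f v w x : smooth_on f -> U x -> 'D_v ('D_w f) x = 'D_w ('D_v f) x.
Proof.
move=> fs Ux; apply: (derive_comm Uo Ux) => [y Uy||]; first exact: smooth_diff.
  by apply: smooth_diff => //; exact: smooth_derive.
by apply: smooth_diff => //; exact: smooth_derive.
Qed.

Lemma deriven_scale m f x v s : smooth_on f -> U x ->
  deriven (s *: v) m f x = s ^+ m * deriven v m f x.
Proof.
move=> fs; elim: m f fs x => [|m IH] f fs x Ux; first by rewrite !deriven0 mul1r.
rewrite (derivenSr _ m).
rewrite (derivenSr v m).
rewrite (IH ('D_(s *: v) f)); [|exact: smooth_derive|exact: Ux].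
rewrite (@deriven_eq _ _ _ (fun x => 0 + s * 'D_v f x)) //; last first.
  move=> y Uy; rewrite add0r -[s *: v]add0r derive_dir ?derive0 ?add0r //.
  exact: smooth_diff.
rewrite deriven_lin //; [|exact: smooth0|exact: smooth_derive].
have -> : deriven v m (fun=> 0) x = 0.
  elim: m {IH} x Ux => [|m IH] x Ux; first by rewrite deriven0.
  by rewrite derivenS (derive_eq_on _ IH) // derive_cst.
by rewrite add0r mulrA exprSr.
Qed.

(** The analytic counterpart of [kpow_line]: commutation of derivatives gathers the [m] first-order
    terms into a single one. *)
Lemma deriven_line m f a x w : smooth_on f -> U a -> exists p : {poly R},
  [/\ forall s, deriven (x + s *: w) m f a = p.[s],
      p`_0 = deriven x m f a
    & p`_1 = m%:R * deriven x m.-1 ('D_w f) a].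
Proof.
move=> + Ua; elim: m f => [|m IH] f fs.
  by exists (f a)%:P; rewrite !coefC mul0r; split=> [s||//]; rewrite deriven0 ?hornerC.
have [p [pE p0 p1]] := IH _ (smooth_derive x fs).
have [q [qE q0 _]] := IH _ (smooth_derive w fs).
exists (p + q * 'X); split=> [s||].
- rewrite !hornerE -pE -qE mulrC -deriven_lin //; [|exact: smooth_derive..].
  rewrite (derivenSr _ m); apply: deriven_eq => // y Uy.
  by rewrite derive_dir //; exact: smooth_diff.
- by rewrite coefD coefMX addr0 p0 (derivenSr x m).
rewrite coefD coefMX /= p1 q0 mulrS mulrDl mul1r addrC; congr (_ + _).
case: m {IH p pE p0 p1 q qE q0} => [|m]; first by rewrite !mul0r.
have DC y : U y -> 'D_w ('D_x f) y = 'D_x ('D_w f) y := @deriveC_on f w x y fs.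
have DSC := etrans (deriven_eq x m DC Ua) (esym (congr1 (@^~ a) (derivenSr x m ('D_w f)))).
exact: (congr1 ( *%R m.+1%:R) DSC).
Qed.

Lemma smooth_line f x : U 0 -> smooth_on f -> exists2 d : R, 0 < d &
  forall m t, `|t| < d ->
    is_derive t (1 : R) (fun s => deriven x m f (s *: x)) (deriven x m.+1 f (t *: x)).
Proof.
move=> U0 fs; have /nbhs_ballP[r /= r0 hr] : nbhs (0 : 'cV[R]_n) U by exact: open_nbhs_nbhs.
(* Adding 1 keeps the divisor positive when [x] is 0. *)
have x1 : 0 < `|x| + 1 by have := normr_ge0 x; lra.
exists (r / (`|x| + 1)); first exact: divr_gt0.
move=> m t; rewrite ltr_pdivlMr // => tr.
have Ut : U (t *: x).
  apply: hr; rewrite -ball_normE /= sub0r normrN normrZ (le_lt_trans _ tr) //.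
  by rewrite ler_wpM2l // lerDl.
have fd := smooth_diff (smooth_deriven x m fs) Ut.
have := @is_derive_line _ _ (deriven x m f) 0 x t.
rewrite add0r derivenS => /(_ (diff_derivable fd)).
have -> // : (fun s : R => deriven x m f (0 + s *: x)) = (fun s => deriven x m f (s *: x)).
by apply/funext => s; rewrite add0r.
Qed.

Lemma smooth_taylor_line f x N : U 0 -> smooth_on f ->
  bigO_pow N (fun t => f (t *: x) - (\poly_(j < N) (deriven x j f 0 / (j`!)%:R)).[t]).
Proof.
move=> U0 fs; have [d d0 h] := smooth_line x U0 fs.
have := @taylor_bigO_pow _ N (fun j t => deriven x j f (t *: x)) d d0 (fun j t _ => h j t).
rewrite deriven0 => H; apply: bigO_pow_ext H _ => t.
by congr (_ - _.[_]); apply: eq_poly => j _; rewrite scale0r.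
Qed.

End Smooth.

Lemma poly_ext (R : realType) (p q : {poly R}) : (forall s, p.[s] = q.[s]) -> p = q.
Proof.
move=> pq; apply/polyP => k; apply/eqP; rewrite -subr_eq0 -coefB; apply/eqP.
apply: (@bigO_pow_coef _ _ k.+1) => //; exists 0, 1; split=> // t _ _.
by rewrite hornerD hornerN pq subrr normr0 mul0r.
Qed.

Lemma kpow_scale (T : comNzRingType) n (s : T) (x : 'cV[T]_n) k :
  kpow (s *: x) k = s ^+ k *: kpow x k.
Proof.
apply/matrixP => l j; rewrite [j]ord1 [in RHS]mxE.
elim: k l => [|k IH] l; first by rewrite !mxE expr0 mul1r.
have [i [l' E]] := kron_seq_entry T l.
by rewrite [LHS](E (fun=> s *: x)) [in RHS](E (fun=> x)) IH mxE exprS mulrACA.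
Qed.

(** * Taylor coefficients of the energy and of its gradient *)

Section TaylorCoefficients.
Variables (R : realType) (n d : nat) (U : set 'cV[R]_n) (E : 'cV[R]_n -> R).
Variables (v : forall k, 'cV[R]_(n ^ k)) (V : forall k, 'M[R]_(n, n ^ k.-1)).
Hypothesis Uo : open U.
Hypothesis U0 : U 0.
Hypothesis Es : smooth_on U E.
Hypothesis vsym : forall k : nat, (2 <= k <= d)%N -> sym_tensor (v k).
Hypothesis vV : forall k : nat, (2 <= k <= d)%N -> v k = recast (vec (V k)).
Hypothesis taylorE : forall x : 'cV[R]_n,
  taylor0 d E x = 2^-1 * \sum_(2 <= k < d.+1) ((v k)^T *m kpow x k) 0 0.

(** At [s *: x] both sides of the Taylor hypothesis are polynomials in [s], by homogeneity of each
    degree; their coefficients are compared. *)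
Lemma deriven_coef k x : (k <= d)%N ->
  deriven x k E 0 = if (2 <= k)%N then (k`!)%:R / 2 * ((v k)^T *m kpow x k) 0 0 else 0.
Proof.
move=> kd.
pose p := \poly_(k < d.+1) ((k`!)%:R^-1 * deriven x k E 0).
pose q := \poly_(k < d.+1) (if (2 <= k)%N then 2^-1 * ((v k)^T *m kpow x k) 0 0 else 0).
have pq : p = q.
  apply: poly_ext => s; have := taylorE (s *: x).
  rewrite /taylor0 !horner_poly => H; transitivity (taylor0 d E (s *: x)).
    apply: eq_bigr => i _.
    have -> : iter i (fun g : 'cV[R]_n -> R => 'D_(s *: x) g) E 0 =
      deriven (s *: x) i E 0 by rewrite deriven.unlock.
    by rewrite (deriven_scale Uo) // mulrA mulrAC.
  rewrite [LHS]H (big_nat_widenl 2 0) // big_mkord big_mkcond mulr_sumr.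
  apply: eq_bigr => i _; case: (2 <= nat_of_ord i)%N; last by rewrite mulr0 mul0r.
  rewrite kpow_scale -scalemxAr; set w := _ *m _.
  by rewrite mxE mulrCA mulrC.
have := congr1 (fun r : {poly R} => (k`!)%:R * r`_k) pq.
rewrite !coef_poly ltnS kd mulrA mulfV ?mul1r => [->|]; last first.
  by rewrite pnatr_eq0 -lt0n fact_gt0.
by case: ifP; rewrite ?mulr0 // mulrA.
Qed.

(** Polarization: the previous identity along [x + s *: w] is compared at first order in [s], and
    the common factor [k] cancels. *)
Lemma grad_coef k x w : (2 <= k <= d)%N ->
  deriven x k.-1 ('D_w E) 0 = (k`!)%:R / 2 * (w^T *m V k *m kpow x k.-1) 0 0.
Proof.
move=> k2d; have /andP[k2 kd] := k2d.
have [p [pE _ p1]] := deriven_line Uo k x w Es U0.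
have [q [qE _ q1]] := sym_kpow_line x w (vsym k2d) (vV k2d).
have pq : p = ((k`!)%:R / 2) *: q.
  by apply: poly_ext => s; rewrite hornerZ -pE -qE deriven_coef // k2.
have k0 : k%:R != 0 :> R by rewrite pnatr_eq0; lia.
by apply: (mulfI k0); rewrite -p1 pq coefZ q1 mulrCA.
Qed.

Lemma grad_coef1 w : (1 <= d)%N -> 'D_w E 0 = 0.
Proof.
move=> d1; have [p [pE _]] := deriven_line Uo 1 0 w Es U0.
have -> : p = 0 by apply: poly_ext => s; rewrite horner0 -pE deriven_coef.
by rewrite coef0 mul1r deriven0 => <-.
Qed.

End TaylorCoefficients.

(** * Matching the coefficients of the Hamilton-Jacobi-Bellman equation *)

Section HJBCoefficients.
Variables (R : realType) (n m d : nat).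
Variables (g : 'I_n -> R -> R) (G : nat -> 'cV[R]_n) (a f : 'cV[R]_n).
Variables (B : 'M[R]_(n, m)) (c e : R).
Hypothesis d0 : (0 < d)%N.
Hypothesis G0 : G 0%N = 0.
Hypothesis e0 : 0 < e.
Hypothesis gG : forall i,
  bigO_pow d (fun t => g i t - (\poly_(j < d) G j i 0).[t]).
Hypothesis hjb : forall t, `|t| < e ->
  \sum_i g i t * (t * a i 0 + t ^+ 2 * f i 0)
  + 2^-1 * \sum_l (\sum_i B i l * g i t) ^+ 2 - c * t ^+ 2 = 0.

(** The gradient is known up to [O(t^d)], but it enters the equation times a drift of order [t] or
    squared, itself being of order [t]. The truncated equation thus holds up to [O(t^(d+1))], which
    reaches the coefficient of [t^d]. *)
Lemma hjb_coef k : (2 <= k <= d)%N ->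
  dotv (G k.-1) a + dotv (G k.-2) f
  + 2^-1 * \sum_(j < k.+1) dotv (B^T *m G j) (B^T *m G (k - j)%N)
  - (k == 2)%:R * c = 0.
Proof.
move=> /andP[k2 kd].
pose P i := \poly_(j < d) G j i 0.
pose Q l := \sum_i B i l *: P i.
pose H := \sum_i (a i 0 *: (P i * 'X) + f i 0 *: (P i * 'X^2))
  + 2^-1 *: (\sum_l Q l * Q l) - c *: 'X^2.
have PO i : bigO_pow 1 (horner (P i)).
  have [q qE] := poly_factorX (P i).
  have P0 : (P i)`_0 = 0 by rewrite coef_poly d0 G0 mxE.
  apply: bigO_pow_ext (bigO_powM (bigO_pow_horner q) (bigO_pow_id R 1)) _.
  by move=> t; rewrite qE P0 addr0 !hornerE.
have QO l : bigO_pow 1 (horner (Q l)).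
  apply: bigO_pow_ext (bigO_pow_sum (F := fun i t => B i l * (P i).[t]) (index_enum 'I_n)
    (P := xpredT) _) _.
    by move=> i _; exact: bigO_powZ.
  by move=> t; rewrite /Q horner_sum; apply: eq_bigr => i _; rewrite hornerZ.
pose b l t := \sum_i B i l * g i t.
have bQ l : bigO_pow d (fun t => b l t - (Q l).[t]).
  apply: bigO_pow_ext (bigO_pow_sum (F := fun i t => B i l * (g i t - (P i).[t]))
    (index_enum 'I_n) (P := xpredT) _) _.
    by move=> i _; exact: bigO_powZ.
  move=> t; rewrite /Q horner_sum -sumrB; apply: eq_bigr => i _.
  by rewrite hornerZ mulrBr.
have HO : bigO_pow d.+1 (horner H).
  have T1 : bigO_pow d.+1 (fun t => \sum_i (g i t - (P i).[t]) * (t ^+ 1 * (a i 0 + t * f i 0))).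
    apply: bigO_pow_sum => i _; have -> : d.+1 = (d + (1 + 0))%N by rewrite addn0 addn1.
    apply: (bigO_powM (gG i)); apply: (bigO_powM (bigO_pow_id R 1)).
    apply: bigO_pow_ext (bigO_pow_horner ((a i 0)%:P + (f i 0) *: 'X)) _ => t.
    by rewrite !hornerE mulrC.
  (* The error on a square is factored as a difference of squares; the sum factor is [O(t)] and
     supplies the extra order. *)
  have T2 : bigO_pow d.+1 (fun t => \sum_l (b l t - (Q l).[t]) * (b l t + (Q l).[t])).
    apply: bigO_pow_sum => l _; rewrite -addn1; apply: (bigO_powM (bQ l)).
    apply: bigO_pow_ext (bigO_powD (bigO_pow_le d0 (bQ l)) (bigO_powZ 2 (QO l))) _ => t.
    by rewrite /=; ring.
  apply: bigO_pow_near (bigO_powZ (-1) (bigO_powD T1 (bigO_powZ 2^-1 T2))) e0 _.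
  move=> t te; have := hjb te.
  rewrite /H hornerD hornerN hornerD !hornerZ hornerXn !horner_sum.
  have -> : \sum_i (g i t - (P i).[t]) * (t ^+ 1 * (a i 0 + t * f i 0)) =
     \sum_i g i t * (t * a i 0 + t ^+ 2 * f i 0) -
     \sum_i (a i 0 *: (P i * 'X) + f i 0 *: (P i * 'X^2)).[t].
    rewrite -sumrB; apply: eq_bigr => i _.
    rewrite hornerD !hornerZ !hornerM !hornerX.
    by move: (P i).[t] => x; ring.
  have -> : \sum_l (b l t - (Q l).[t]) * (b l t + (Q l).[t]) =
     \sum_l (\sum_i B i l * g i t) ^+ 2 - \sum_l (Q l * Q l).[t].
    rewrite -sumrB; apply: eq_bigr => l _; rewrite hornerM -[\sum_i B i l * g i t]/(b l t).
    by move: (b l t) (Q l).[t] => x y; ring.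
  move: (\sum_i g i t * _) (\sum_l _ ^+ 2) (\sum_l _.[t]) (\sum_i _.[t]) => x y z w h.
  transitivity (w + 2^-1 * z - c * t ^+ 2 - (x + 2^-1 * y - c * t ^+ 2)); first by ring.
  by rewrite h subr0.
have Qc l j : (j < d)%N -> (Q l)`_j = (B^T *m G j) l 0.
  move=> jd; rewrite /Q coef_sum mxE; apply: eq_bigr => i _.
  by rewrite coefZ coef_poly jd mxE.
have BG0 l : (B^T *m G 0%N) l 0 = 0 by rewrite G0 mulmx0 mxE.
have QQ l : (Q l * Q l)`_k =
    \sum_(j < k.+1) (B^T *m G j) l 0 * (B^T *m G (k - j)%N) l 0.
  rewrite coefM; apply: eq_bigr => -[j jk] _ /=.
  (* The truncation stops below degree [d], so for [k = d] the end terms fall outside it; they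
     vanish since [G 0] is 0. *)
  have [j0|j0] := posnP j; first by rewrite j0 (Qc l 0%N d0) BG0 !mul0r.
  have [kj0|kj0] := posnP (k - j); first by rewrite kj0 (Qc l 0%N d0) BG0 !mulr0.
  by rewrite !Qc //; lia.
have := bigO_pow_coef HO kd.
rewrite /H coefB coefD !coefZ coefXn !coef_sum => Hk; rewrite -[RHS]Hk.
congr (_ + _ - _); last by rewrite mulrC.
- rewrite !dotvE -big_split /=; apply: eq_bigr => i _.
  rewrite coefD !coefZ coefMX coefMXn !coef_poly.
  have -> : (k == 0) = false by lia.
  have -> : (k < 2)%N = false by lia.
  have -> : (k.-1 < d)%N by lia.
  have -> : (k - 2 < d)%N by lia.
  by rewrite subn2 mulrC [G _ _ _ * _]mulrC.
- congr (_ * _); under [RHS]eq_bigr do rewrite QQ.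
  by rewrite [RHS]exchange_big /=; apply: eq_bigr => j _; rewrite dotvE.
Qed.

End HJBCoefficients.

(** * Instability *)

Section Instability.
Variable R : realType.

Lemma entry_le_norm p q (x : 'M[R]_(p, q)) i j : `|x i j| <= `|x|.
Proof.
rewrite [leRHS]mx_normrE.
exact: (le_bigmax _ (fun ij : 'I_p * 'I_q => `|x ij.1 ij.2|) (i, j)).
Qed.

Lemma norm_sqr_le_dotv n (x : 'cV[R]_n) : `|x| ^+ 2 <= dotv x x.
Proof.
have [->|x0] := eqVneq `|x| 0; first by rewrite expr2 mul0r dotvv_ge0.
(* The matrix norm is the largest modulus of an entry, attained here. *)
have [[i j] /= xE] := mx_norm_neq0 x0.
rewrite [X in X ^+ 2](xE : `|x| = _) [j]ord1 real_normK ?num_real // dotvE (bigD1 i) //= -expr2.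
by rewrite lerDl; apply: sumr_ge0 => k _; rewrite -expr2 sqr_ge0.
Qed.

Lemma mulmx_entry_bound p q (Q : 'M[R]_(p, q)) : exists2 c, 0 <= c &
  forall (x : 'cV[R]_q) al, 0 <= al -> (forall i, `|x i 0| <= al) ->
    forall i, `|(Q *m x) i 0| <= c * al.
Proof.
exists (\sum_i \sum_j `|Q i j|) => [|x al al0 xal i].
  by apply: sumr_ge0 => i _; apply: sumr_ge0.
rewrite mxE (le_trans (ler_norm_sum _ _ _)) // mulr_suml (bigD1 i) //=.
rewrite -[leLHS]addr0 lerD //; last first.
  by apply: sumr_ge0 => k _; rewrite mulr_ge0 // sumr_ge0.
by rewrite mulr_suml; apply: ler_sum => j _; rewrite normrM ler_wpM2l.
Qed.

Lemma dotv_bound n (x y : 'cV[R]_n) al be : (forall i, `|x i 0| <= al) ->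
  (forall i, `|y i 0| <= be) -> `|dotv x y| <= n%:R * (al * be).
Proof.
move=> xal ybe; rewrite dotvE (le_trans (ler_norm_sum _ _ _)) //.
rewrite (le_trans (ler_sum _ (G := fun=> al * be) _)) => [//|i _|].
  by rewrite normrM ler_pM.
by rewrite sumr_const card_ord mulr_natl.
Qed.

Lemma continuous_sumr (T : topologicalType) (I : Type) (r : seq I) (F : I -> T -> R) :
  (forall i, continuous (F i)) -> continuous (fun x => \sum_(i <- r) F i x).
Proof.
move=> Fc; elim: r => [|i r IH].
  have -> : (fun x => \sum_(i <- [::]) F i x) = (fun=> 0).
    by apply/funext => x; rewrite big_nil.
  by move=> x; exact: cst_continuous.
have -> : (fun x => \sum_(j <- i :: r) F j x) = (fun x => F i x + \sum_(j <- r) F j x).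
  by apply/funext => x; rewrite big_cons.
by move=> x; apply: (@continuousD _ _ _ (F i)); [exact: Fc|exact: IH].
Qed.

Lemma dotv_bilinear_continuous n (H : 'M[R]_n) :
  continuous (fun x : 'cV[R]_n => dotv x (H *m x)).
Proof.
have -> : (fun x : 'cV[R]_n => dotv x (H *m x)) =
    (fun x : 'cV[R]_n => \sum_i \sum_j x i 0 * (H i j * x j 0)).
  apply/funext => x; rewrite dotvE; apply: eq_bigr => i _.
  by rewrite mxE mulr_sumr.
apply: continuous_sumr => i; apply: continuous_sumr => j x.
apply: (@continuousM _ _ (fun x : 'cV[R]_n => x i 0) (fun x => H i j * x j 0)).
  exact: coord_continuous.
apply: (@continuousM _ _ (fun=> H i j) (fun x : 'cV[R]_n => x j 0)).
  exact: cst_continuous.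
exact: coord_continuous.
Qed.

Lemma is_derive_entry n (x : R -> 'cV[R]_n) (t : R) y i :
  is_derive t (1 : R) x y -> is_derive t (1 : R) (fun s => x s i 0) (y i 0).
Proof.
move=> [xd <-]; apply: DeriveDef; first by move/derivable_mxP: xd; exact.
by rewrite derive_mx // mxE.
Qed.

Lemma is_derive_quad n (H : 'M[R]_n) (x : R -> 'cV[R]_n) (t : R) y :
  is_derive t (1 : R) x y ->
  is_derive t (1 : R) (fun s => dotv (x s) (H *m x s))
    (dotv y (H *m x t) + dotv (x t) (H *m y)).
Proof.
move=> xd.
have Hxd i : is_derive t (1 : R) (fun s => (H *m x s) i 0) ((H *m y) i 0).
  have -> : (fun s => (H *m x s) i 0) = \sum_j (fun s => H i j * x s j 0).
    by apply/funext => s; rewrite mxE fct_sumE.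
  rewrite mxE; apply: is_derive_sum => j.
  by have xj := is_derive_entry j xd; apply: is_deriveZ.
have -> : (fun s => dotv (x s) (H *m x s)) =
    \sum_i ((fun s => x s i 0) * (fun s => (H *m x s) i 0)).
  by apply/funext => s; rewrite dotvE fct_sumE.
rewrite !dotvE -big_split /=; apply: is_derive_sum => i.
have xi := is_derive_entry i xd; have Hi := Hxd i.
by apply: is_derive_eq (is_deriveM xi Hi) _; rewrite addrC [y i 0 * _]mulrC.
Qed.

(** A trajectory starting close to 0 on the ray of [x0] stays in the region where the form does not
    decrease. The form remains above a positive value, although the trajectory tends to 0. *)
Lemma chetaev_unstable n (f : 'cV[R]_n -> 'cV[R]_n) (H : 'M[R]_n) x0 :
  asymptotically_stable f -> 0 < dotv x0 (H *m x0) ->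
  (\forall x \near (0 : 'cV[R]_n), 0 <= dotv (f x) (H *m x) + dotv x (H *m f x)) ->
  False.
Proof.
move=> [fex fst fat] x0H /nbhs_ballP[r /= r0 hr].
have [d d0 hd] := fst r r0; have [d' d0' hd'] := fat.
have /nbhs_ballP[q /= q0 hq] := fex.
(* The three radii are those for stability, attraction and existence of a trajectory. *)
pose m := Num.min (Num.min d d') q; have m0 : 0 < m by rewrite !lt_min d0 d0' q0.
have x1 : 0 < `|x0| + 1 by have := normr_ge0 x0; lra.
pose s := m / (`|x0| + 1); have s0 : 0 < s by exact: divr_gt0.
have sx : `|s *: x0| < m.
  rewrite normrZ gtr0_norm // /s mulrAC ltr_pdivrMr // ltr_pM2l //; lra.
have := sx; rewrite !lt_min => /andP[/andP[sd sd'] sq].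
have [|x xf xE] := hq (s *: x0); first by rewrite -ball_normE /= sub0r normrN.
have xr t : 0 <= t -> `|x t| < r by move=> t0; apply: hd t0 => //; rewrite xE.
have xlim : x t @[t --> +oo] --> (0 : 'cV[R]_n) by apply: hd'; rewrite // xE.
have [xc xd] := xf.
pose u t := dotv (x t) (H *m x t).
have ud (t : R) : 0 < t -> is_derive t (1 : R) u
    (dotv (f (x t)) (H *m x t) + dotv (x t) (H *m f (x t))).
  by move=> t0; apply: is_derive_quad; exact: xd.
have uge t : 0 <= t -> u 0 <= u t.
  apply: ger0_derive1_ndecry => //.
  - by move=> y; rewrite in_itv /= andbT => /ud [].
  - move=> y; rewrite in_itv /= andbT => y0; rewrite derive1E; have [_ ->] := ud y y0.
    by apply: hr; rewrite -ball_normE /= sub0r normrN; apply: xr; exact: ltW.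
  by move=> y; exact: (continuous_comp (xc y) (@dotv_bilinear_continuous n H (x y))).
have ulim : u t @[t --> +oo] --> (0 : R).
  have := cvg_comp _ _ xlim (@dotv_bilinear_continuous n H 0).
  by rewrite mulmx0 dotv0.
have : u 0 <= 0.
  apply: (cvgr_to_ge ulim); near=> t; apply: uge; near: t.
  by apply: nbhs_pinfty_ge; exact: num_real.
rewrite /u xE -scalemxAr dotvZl dotvZr; have := mulr_gt0 s0 (mulr_gt0 s0 x0H); lra.
Unshelve. all: by end_near.
Qed.

End Instability.

(** * Taylor coefficients of the past energy *)

Lemma kpow1 (T : comNzRingType) n (x : 'cV[T]_n) : kpow x 1 = x :> 'cV[T]_n.
Proof.
rewrite -[LHS]/(kron_seq 1 (fun=> x)) kron_seq1.
exact: (recast_id (x : 'cV[T]_(n ^ 1))).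
Qed.

Section PastEnergy.
Variables (R : realType) (n m p d : nat).
Variables (A : 'M[R]_n) (F : 'M[R]_(n, n ^ 2)) (B : 'M[R]_(n, m)) (C : 'M[R]_(p, n)).
Variables (eta : R) (E : 'cV[R]_n -> R) (U : set 'cV[R]_n).
Variables (v : forall k, 'cV[R]_(n ^ k)) (V : forall k, 'M[R]_(n, n ^ k.-1)).
Hypothesis d2 : (2 <= d)%N.
Hypothesis Uo : open U.
Hypothesis U0 : U 0.
Hypothesis Es : smooth_on U E.
Hypothesis vsym : forall k : nat, (2 <= k <= d)%N -> sym_tensor (v k).
Hypothesis vV : forall k : nat, (2 <= k <= d)%N -> v k = recast (vec (V k)).
Hypothesis taylorE : forall x : 'cV[R]_n,
  taylor0 d E x = 2^-1 * \sum_(2 <= k < d.+1) ((v k)^T *m kpow x k) 0 0.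
Hypothesis hjbE : \forall x \near (0 : 'cV[R]_n), past_HJB eta A F B C E x.

Let V2 : 'M[R]_n := V 2.

(* The coefficient of [t ^ j] in the gradient of [E] at [t *: x]. *)
Definition grad_term (x : 'cV[R]_n) (j : nat) : 'cV[R]_n :=
  if j is 0 then 0 else (j.+1%:R / 2) *: (V j.+1 *m kpow x j).

Lemma delta_tr_mul q (x : 'M[R]_(n, q)) i : (delta_mx i 0 : 'cV[R]_n)^T *m x = row i x.
Proof. by rewrite trmx_delta -rowE. Qed.

Lemma grad_expansion x i : bigO_pow d (fun t =>
  'D_(delta_mx i 0) E (t *: x) - (\poly_(j < d) grad_term x j i 0).[t]).
Proof.
have := smooth_taylor_line Uo x d U0 (smooth_derive Uo (delta_mx i 0) Es).
move=> HO; apply: bigO_pow_ext HO _ => t; congr (_ - _.[t]).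
apply/polyP => j; rewrite !coef_poly; case: ifP => // jd.
case: j jd => [|j] jd.
  by rewrite deriven0 (grad_coef1 Uo U0 Es taylorE _ (ltnW d2)) mul0r mxE.
have jd2 : (2 <= j.+2 <= d)%N by [].
(* With [k = j.+2], the quotient of [k!] by [(k - 1)!] leaves the factor [k / 2] of [grad_term]. *)
rewrite (@grad_coef _ _ _ _ _ _ V Uo U0 Es vsym vV taylorE j.+2) //=.
rewrite -mulmxA delta_tr_mul [in RHS]mxE [in LHS]mxE factS natrM.
by field; rewrite pnatr_eq0 -lt0n fact_gt0.
Qed.

Lemma hjb_identity x k : (2 <= k <= d)%N ->
  dotv (grad_term x k.-1) (A *m x)
  + dotv (grad_term x k.-2) (F *m (tensmx x x : 'cV_(n ^ 2)))
  + 2^-1 * \sum_(j < k.+1) dotv (B^T *m grad_term x j) (B^T *m grad_term x (k - j)%N)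
  - (k == 2)%:R * (eta / 2 * dotv (C *m x) (C *m x)) = 0.
Proof.
move=> kd; have /nbhs_ballP[r /= r0 hr] := hjbE.
have x1 : 0 < `|x| + 1 by have := normr_ge0 x; lra.
apply: (@hjb_coef _ _ _ d (fun i t => 'D_(delta_mx i 0) E (t *: x)) _ _ _ _ _
  (r / (`|x| + 1)) _ _ _ (grad_expansion x)) => //; [exact: ltnW|exact: divr_gt0|].
move=> t; rewrite ltr_pdivlMr // => tr.
have tx : ball (0 : 'cV[R]_n) r (t *: x).
  rewrite -ball_normE /= sub0r normrN normrZ (le_lt_trans _ tr) //.
  by rewrite ler_wpM2l // lerDl.
have := hr _ tx; rewrite /past_HJB.
set g := grad E (t *: x).
have -> : quad_drift A F (t *: x) =
    t *: (A *m x) + t ^+ 2 *: (F *m (tensmx x x : 'cV_(n ^ 2))).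
  rewrite /quad_drift -scalemxAr; congr (_ + _).
  rewrite scalemxAr; congr (_ *m _); apply/matrixP => i j; rewrite !mxE.
  by rewrite mulrACA expr2.
move=> /(congr1 (fun M : 'M[R]_1 => M 0 0)).
have eD (M N : 'M[R]_1) : (M + N) 0 0 = M 0 0 + N 0 0 by rewrite mxE.
have eN (M : 'M[R]_1) : (- M) 0 0 = - M 0 0 by rewrite mxE.
have eZ c (M : 'M[R]_1) : (c *: M) 0 0 = c * M 0 0 by rewrite mxE.
rewrite !eD eN !eZ.
have -> : (g *m (t *: (A *m x) + t ^+ 2 *: (F *m (tensmx x x : 'cV_(n ^ 2))))) 0 0 =
    \sum_i 'D_(delta_mx i 0) E (t *: x) *
      (t * (A *m x) i 0 + t ^+ 2 * (F *m (tensmx x x : 'cV_(n ^ 2))) i 0).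
  rewrite mxE; apply: eq_bigr => i _; rewrite [g _ _]mxE; congr (_ * _).
  by rewrite mxE; congr (_ + _); rewrite mxE.
have -> : (g *m B *m B^T *m g^T) 0 0 =
    \sum_l (\sum_i B i l * 'D_(delta_mx i 0) E (t *: x)) ^+ 2.
  rewrite -mulmxA -trmx_mul mxE; apply: eq_bigr => l _.
  rewrite [X in _ * X]mxE -expr2; congr (_ ^+ 2).
  by rewrite mxE; apply: eq_bigr => i _; rewrite [g _ _]mxE mulrC.
have -> : ((t *: x)^T *m C^T *m C *m (t *: x)) 0 0 = dotv (C *m x) (C *m x) * t ^+ 2.
  rewrite -mulmxA -trmx_mul -/(dotv (C *m (t *: x)) (C *m (t *: x))) -scalemxAr.
  by rewrite dotvZl dotvZr mulrA mulrC expr2.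
by rewrite mxE mulrA => <-.
Qed.

Lemma V2_sym : V2^T = V2.
Proof.
have v2 : (2 <= 2 <= d)%N by rewrite d2.
have key (x y : 'cV[R]_n) : (y^T *m V2 *m x) 0 0 = (x^T *m V2 *m y) 0 0.
  (* Both evaluations are at [y] tensor [x]: [y] inserted first among copies of [x], or [x] inserted
     second among copies of [y]. *)
  have := vec_set_slot x y (vsym v2) (vV v2) (i := 0) isT.
  have := vec_set_slot y x (vsym v2) (vV v2) (i := 1) isT.
  by rewrite /= !kpow1 => <- <-; congr ((_ *m kron_seq _ _) _ _).
apply/matrixP => i j; rewrite mxE.
have := key (delta_mx i 0) (delta_mx j 0).
by rewrite !delta_tr_mul -!colE !mxE => ->.
Qed.

Lemma grad_term1 x : grad_term x 1 = V2 *m x.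
Proof. by rewrite /grad_term kpow1 divff ?pnatr_eq0 // scale1r. Qed.

(** The coefficient of [t^2] says that the quadratic form of the residual vanishes; the residual is
    symmetric, hence zero. *)
Lemma V2_riccati :
  A^T *m V2 + V2 *m A - eta *: (C^T *m C) + V2 *m B *m B^T *m V2 = 0.
Proof.
set M := (X in X = 0).
have Ms : M^T = M.
  rewrite /M !linearD linearN linearZ /= !trmx_mul !trmxK V2_sym.
  by rewrite !mulmxA [V2 *m A + _]addrC.
have M0 x : dotv x (M *m x) = 0.
  have h : (2 <= 2 <= d)%N by rewrite d2.
  pose q (i j : nat) := dotv (B^T *m grad_term x i) (B^T *m grad_term x j).
  have H0 : dotv (grad_term x 1) (A *m x)
    + dotv (grad_term x 0) (F *m (tensmx x x : 'cV_(n ^ 2)))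
    + 2^-1 * (q 0%N 2 + (q 1%N 1%N + (q 2 0%N + 0)))
    - 1 * (eta / 2 * dotv (C *m x) (C *m x)) = 0.
    by have := hjb_identity x h; rewrite !big_ord_recl big_ord0.
  rewrite /q -[grad_term x 0]/0 !mulmx0 dotv0 !(dotvC 0) !dotv0 grad_term1 in H0.
  rewrite /M !mulmxDl mulNmx !dotvDr dotvNr -scalemxAl dotvZr.
  have -> : dotv x (A^T *m V2 *m x) = dotv (V2 *m x) (A *m x).
    by rewrite -mulmxA dotv_mulr trmxK dotvC.
  have -> : dotv x (V2 *m A *m x) = dotv (V2 *m x) (A *m x).
    by rewrite -mulmxA dotv_mulr V2_sym.
  have -> : dotv x (C^T *m C *m x) = dotv (C *m x) (C *m x).
    by rewrite -mulmxA dotv_mulr trmxK.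
  have -> : dotv x (V2 *m B *m B^T *m V2 *m x) = dotv (B^T *m (V2 *m x)) (B^T *m (V2 *m x)).
    by rewrite -!mulmxA dotv_mulr V2_sym dotv_mulr.
  by lra.
apply/matrixP => i j.
have Mpos x : 0 <= dotv x (M *m x) by rewrite M0.
have := psd_kernel Ms Mpos (M0 (delta_mx j 0)).
by rewrite -colE => /matrixP /(_ i 0); rewrite !mxE.
Qed.

(** The gradient vanishes at 0 and its derivative there is [V2], so [M] below is the linearization
    of the past field. *)
Lemma grad_near0 (e : R) : 0 < e -> \forall x \near (0 : 'cV[R]_n),
  forall i, `|((grad E x)^T - V2 *m x) i 0| <= e * `|x|.
Proof.
move=> e0.
suff h i : \forall x \near (0 : 'cV[R]_n), `|((grad E x)^T - V2 *m x) i 0| <= e * `|x|.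
  exact: (@filter_forall _ _ _ (nbhs (0 : 'cV[R]_n)) (nbhs_filter _) h).
have Ei := smooth_derive Uo (delta_mx i 0) Es.
have [r r0 hr] := differentiable_eps (smooth_diff Ei U0) e0.
apply/nbhs_ballP; exists r => //= x; rewrite -ball_normE /= sub0r normrN => /hr.
rewrite add0r (grad_coef1 Uo U0 Es taylorE _ (ltnW d2)) subr0.
have k2 : (2 <= 2 <= d)%N by rewrite d2.
have := grad_coef Uo U0 Es vsym vV taylorE x (delta_mx i 0) k2.
rewrite /= derivenS deriven0 divff ?pnatr_eq0 // mul1r kpow1 -mulmxA delta_tr_mul => ->.
by rewrite !mxE.
Qed.

(** The field differs from its linearization by a small multiple of [|x|], too little to undo the
    definite derivative of the form near 0. *)
Lemma stable_no_positive_direction (H : 'M[R]_n) :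
  asymptotically_stable (past_field A F B E) ->
  let M := - (A + B *m B^T *m V2) in
  (forall x, 2^-1 * dotv x x <= dotv (M *m x) (H *m x) + dotv x (H *m (M *m x))) ->
  forall x0, dotv x0 (H *m x0) <= 0.
Proof.
move=> stab M HM x0; rewrite leNgt; apply/negP => x0H.
apply: (chetaev_unstable stab x0H).
have [cH cH0 hH] := mulmx_entry_bound (H + H^T).
have [cB cB0 hB] := mulmx_entry_bound (B *m B^T).
have [cF cF0 hF] := mulmx_entry_bound F.
(* With [|r| <= e |x|] entrywise, the perturbation is at most half of [|x|^2]. One half of [e] is
   spent on the quadratic drift, the other on the gradient error. *)
pose e := (2 * (n%:R * cH + 1))^-1 : R.
have n0 : 0 <= n%:R * cH by rewrite mulr_ge0.
have e0 : 0 < e by rewrite invr_gt0; lra.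
have eB : 0 < e / (2 * (cB + 1)) by rewrite divr_gt0 //; lra.
have eF : 0 < e / (2 * (cF + 1)) by rewrite divr_gt0 //; lra.
have xF : \forall x \near (0 : 'cV[R]_n), `|x| < e / (2 * (cF + 1)).
  apply/nbhs_ballP; exists (e / (2 * (cF + 1))) => //= x.
  by rewrite -ball_normE /= sub0r normrN.
apply: filterS2 (grad_near0 eB) xF => x xG xF.
pose r := past_field A F B E x - M *m x.
have x0' := normr_ge0 x.
have rE : r = - (F *m (tensmx x x : 'cV_(n ^ 2))
    + B *m B^T *m ((grad E x)^T - V2 *m x)).
  rewrite /r /past_field /quad_drift /M mulNmx opprK mulmxDl mulmxBr !mulmxA.
  move: (A *m x) (F *m _) (B *m B^T *m _) (B *m B^T *m V2 *m x) => a b c c'.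
  by apply/matrixP => i j; rewrite !mxE; ring.
have rb i : `|r i 0| <= e * `|x|.
  rewrite rE mxE normrN mxE (le_trans (ler_normD _ _)) //.
  have h1 : `|(F *m (tensmx x x : 'cV_(n ^ 2))) i 0| <= cF * `|x| ^+ 2.
    apply: hF; first exact: sqr_ge0.
    by move=> l; rewrite mxE normrM expr2 ler_pM ?entry_le_norm.
  have h2 := hB _ _ (mulr_ge0 (ltW eB) x0') xG i.
  have h3 : cF * `|x| ^+ 2 <= e / 2 * `|x|.
    rewrite expr2 mulrA ler_wpM2r //; move: xF; rewrite ltr_pdivlMr; lra.
  have h4 : cB * (e / (2 * (cB + 1)) * `|x|) <= e / 2 * `|x|.
    rewrite mulrA ler_wpM2r // mulrCA ler_wpM2l ?(ltW e0) // ler_pdivrMr; lra.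
  lra.
have fE : past_field A F B E x = M *m x + r by rewrite /r addrC subrK.
have -> : dotv (past_field A F B E x) (H *m x) + dotv x (H *m past_field A F B E x) =
   dotv (M *m x) (H *m x) + dotv x (H *m (M *m x)) + dotv r ((H + H^T) *m x).
  rewrite fE mulmxDr dotvDl dotvDr mulmxDl dotvDr.
  have -> : dotv x (H *m r) = dotv r (H^T *m x) by rewrite dotv_mulr dotvC.
  lra.
have := HM x; have := dotv_bound rb (hH x _ x0' (fun i => entry_le_norm x i 0)).
have := norm_sqr_le_dotv x.
have : n%:R * (e * `|x| * (cH * `|x|)) <= 2^-1 * `|x| ^+ 2.
  rewrite (_ : n%:R * _ = n%:R * cH * e * `|x| ^+ 2); last by ring.
  by rewrite ler_wpM2r ?sqr_ge0 // /e ler_pdivrMr; lra.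
rewrite ler_norml => h1 h2 /andP[h3 _] h4; lra.
Qed.

Lemma grad_termE x k : (1 < k)%N ->
  grad_term x k.-1 = (k%:R / 2) *: (V k *m kpow x k.-1).
Proof. by case: k => [|[|k]]. Qed.

(** For [i] between 3 and [k - 1], the only admissible [j] is [k + 2 - i], which lies in the same
    range. *)
Lemma sum_pairs_eq (k i : nat) (c : nat -> R) : (3 <= i < k)%N ->
  \sum_(3 <= j < k | (i + j == k + 2)%N) c j = c (k + 2 - i)%N.
Proof.
move=> ik; rewrite -big_filter (_ : seq.filter _ _ = [:: (k + 2 - i)%N]) ?big_seq1 //.
apply: perm_small_eq; first by [].
apply: uniq_perm; rewrite ?filter_uniq ?iota_uniq //.
by move=> j; rewrite mem_filter mem_index_iota inE; lia.
Qed.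

Lemma hjb_identity_high x k : (2 < k <= d)%N ->
  k%:R * (((A + B *m B^T *m V2) *m x)^T *m V k *m kpow x k.-1) 0 0
  + k.-1%:R * ((F *m (tensmx x x : 'cV_(n ^ 2)))^T *m V k.-1 *m kpow x k.-2) 0 0
  + 4^-1 * \sum_(3 <= i < k) \sum_(3 <= j < k | (i + j == k + 2)%N) (i * j)%:R *
      ((kpow x i.-1)^T *m ((V i)^T *m B *m B^T *m V j) *m kpow x j.-1) 0 0 = 0.
Proof.
move=> /andP[k2 kd].
pose q i j := dotv (B^T *m grad_term x i) (B^T *m grad_term x j).
have q0 i : q i 0%N = 0 by rewrite /q mulmx0 dotv0.
have qC i j : q i j = q j i by rewrite /q dotvC.
have kd2 : (2 <= k <= d)%N by rewrite (ltnW k2).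
have := hjb_identity x kd2; rewrite gtn_eqF // mul0r subr0.
(* The terms 0 and [k] vanish with the constant term of the gradient; the terms 1 and [k - 1] pair
   [V2] with [V k] and will join the drift. *)
rewrite -(big_mkord xpredT (fun j => q j (k - j)%N)).
rewrite big_ltn // big_ltn; last by lia.
rewrite big_nat_recr /=; last by lia.
rewrite -[X in \sum_(2 <= i < X) _](prednK (ltnW (ltnW k2))) big_nat_recr /=; last by lia.
rewrite subnn q0 qC q0 subn1 (_ : (k - k.-1)%N = 1%N); last by lia.
(* Gradient degrees become energy degrees, one higher, so pairs of sum [k] become pairs of sum
   [k + 2]. *)
rewrite (qC k.-1) -(big_add1 _ _ 2 k xpredT (fun j => q j.-1 (k - j.-1)%N)).
have -> : \sum_(3 <= j < k) q j.-1 (k - j.-1)%N =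
    4^-1 * \sum_(3 <= i < k) \sum_(3 <= j < k | (i + j == k + 2)%N) (i * j)%:R *
      ((kpow x i.-1)^T *m ((V i)^T *m B *m B^T *m V j) *m kpow x j.-1) 0 0.
  rewrite mulr_sumr; apply: eq_big_nat => i ik; rewrite sum_pairs_eq //.
  set j := (k + 2 - i)%N; have -> : (k - i.-1)%N = j.-1 by rewrite /j; lia.
  rewrite /q !grad_termE; [|by rewrite /j; lia|by lia].
  rewrite -!scalemxAr dotvZl dotvZr natrM.
  have -> : ((kpow x i.-1)^T *m ((V i)^T *m B *m B^T *m V j) *m kpow x j.-1) 0 0 =
      dotv (B^T *m (V i *m kpow x i.-1)) (B^T *m (V j *m kpow x j.-1)).
    by rewrite /dotv !trmx_mul trmxK !mulmxA.
  by field.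
have -> : q 1%N k.-1 = k%:R / 2 * dotv (B *m B^T *m V2 *m x) (V k *m kpow x k.-1).
  rewrite /q grad_termE; last by lia.
  by rewrite grad_term1 -scalemxAr dotvZr dotv_mulr trmxK !mulmxA.
have -> : dotv (grad_term x k.-1) (A *m x) =
    k%:R / 2 * dotv (A *m x) (V k *m kpow x k.-1).
  by rewrite grad_termE ?dotvZl 1?dotvC //; lia.
have -> : dotv (grad_term x k.-2) (F *m (tensmx x x : 'cV_(n ^ 2))) =
    k.-1%:R / 2 * dotv (F *m (tensmx x x : 'cV_(n ^ 2))) (V k.-1 *m kpow x k.-2).
  by rewrite grad_termE ?dotvZl 1?dotvC //; lia.
have -> : (((A + B *m B^T *m V2) *m x)^T *m V k *m kpow x k.-1) 0 0 =
    dotv (A *m x) (V k *m kpow x k.-1) +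
    dotv (B *m B^T *m V2 *m x) (V k *m kpow x k.-1).
  by rewrite -mulmxA -/(dotv _ _) mulmxDl dotvDl.
have -> : ((F *m (tensmx x x : 'cV_(n ^ 2)))^T *m V k.-1 *m kpow x k.-2) 0 0 =
    dotv (F *m (tensmx x x : 'cV_(n ^ 2))) (V k.-1 *m kpow x k.-2).
  by rewrite -mulmxA.
set S := \sum_(3 <= i < k) _; set u := dotv (A *m x) _.
set w := dotv (F *m _) _; set z := dotv (B *m B^T *m V2 *m x) _ => h.
(* Doubling merges the two equal pairings of [V2] with [V k] into the term of [A]. *)
transitivity (2 * (k%:R / 2 * u + k.-1%:R / 2 * w + 2^-1 *
  (0 + (k%:R / 2 * z + (4^-1 * S + k%:R / 2 * z + 0))))); first by field.
by rewrite h mulr0.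
Qed.

End PastEnergy.

(** * The inverse of the filter Riccati solution and the comparison with [V2] *)

Lemma hurwitz_conj (R : realType) n (Y N : 'M[R]_n) : Y \in unitmx ->
  hurwitz (Y *m N *m invmx Y) -> hurwitz N.
Proof.
move=> Yu h z zN; apply: h; move: zN; rewrite !eigenvalue_unitmx; apply: contra.
have YC : toC Y \in unitmx by rewrite map_unitmx.
have -> : toC (Y *m N *m invmx Y) - z%:M = toC Y *m (toC N - z%:M) *m invmx (toC Y).
  rewrite /toC !map_mxM map_invmx mulmxBr mulmxBl; congr (_ - _).
  by rewrite -scalemx1 -scalemxAr mulmx1 -scalemxAl mulmxV // scalemx1.
by rewrite !unitmx_mul unitmx_inv YC /= andbT.
Qed.

Lemma posdef_unitmx (R : realType) n (Y : 'M[R]_n) : posdef Y -> Y \in unitmx.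
Proof.
move=> [Ys Yp]; rewrite -row_free_unit -kermx_eq0; apply: contraT => /rowV0Pn[u uk u0].
have := Yp u^T; rewrite trmxK -trmx0 (inj_eq trmx_inj) => /(_ u0).
by rewrite (sub_kermxP uk) mul0mx mxE ltxx.
Qed.

Lemma posdef_invmx (R : realType) n (Y : 'M[R]_n) : posdef Y -> posdef (invmx Y).
Proof.
move=> Yp; have Yu := posdef_unitmx Yp; have [Ys Ypos] := Yp.
split=> [|x x0]; first by rewrite trmx_inv Ys.
have /Ypos : invmx Y *m x != 0.
  by apply: contra_neq x0 => h; rewrite -[x]mul1mx -(mulmxV Yu) -mulmxA h mulmx0.
by rewrite trmx_mul trmx_inv Ys -!mulmxA (mulmxA Y) mulmxV // mul1mx !mulmxA.
Qed.

(** The filter equation is multiplied by [P] on both sides, and [Y] conjugates the transpose of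
    [- (A + B *m B^T *m P)] into the Hurwitz filter matrix. *)
Lemma invmx_filter_are (R : realType) n m p (eta : R) (A : 'M[R]_n)
    (B : 'M[R]_(n, m)) (C : 'M[R]_(p, n)) Y (P := invmx Y) :
  filter_are_solution eta A B C Y ->
  A^T *m P + P *m A - eta *: (C^T *m C) + P *m B *m B^T *m P = 0 /\
  hurwitz (- (A + B *m B^T *m P)).
Proof.
move=> [Yp Yare Yh]; have Yu := posdef_unitmx Yp; have [Ys _] := Yp.
have Ps : P^T = P by rewrite /P trmx_inv Ys.
split.
  have := congr1 (fun Z => P *m Z *m P) Yare.
  rewrite /= mulmx0 mul0mx => <-.
  rewrite !(mulmxDr, mulmxDl) mulmxN mulNmx -!scalemxAr -!scalemxAl !mulmxA.
  rewrite mulVmx // !mul1mx -!mulmxA mulmxV // !mulmx1 !mulmxA.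
  by rewrite [RHS]addrAC (addrC (P *m A)).
rewrite -[X in hurwitz X]trmxK; apply: hurwitz_trmx; apply: (hurwitz_conj Yu).
have -> // : Y *m (- (A + B *m B^T *m P))^T *m invmx Y = A - eta *: (Y *m C^T *m C).
rewrite linearN linearD /= !trmx_mul trmxK Ps mulmxN mulNmx mulmxDr.
have /eqP := Yare; rewrite subr_eq0 => /eqP YE.
have -> : Y *m (P *m (B *m B^T)) = B *m B^T by rewrite mulmxA mulmxV // mul1mx.
have -> : Y *m A^T + B *m B^T = eta *: (Y *m C^T *m C *m Y) - A *m Y.
  by rewrite -YE addrAC [A *m Y + _]addrC addrK.
by rewrite mulmxBl opprB -scalemxAl -!mulmxA mulmxV // !mulmx1.
Qed.

(** Subtracting the two equations leaves a Lyapunov equation for the closed loop of [P], in the form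
    shared by [chetaev_form] and [lyapunov_psd_eq0]. *)
Lemma riccati_difference (R : realType) n m (A Q P V : 'M[R]_n) (B : 'M[R]_(n, m)) :
  P^T = P -> A^T *m P + P *m A - Q + P *m B *m B^T *m P = 0 ->
  A^T *m V + V *m A - Q + V *m B *m B^T *m V = 0 ->
  (A + B *m B^T *m P)^T *m (P - V) + (P - V) *m (A + B *m B^T *m P) =
    (P - V) *m B *m B^T *m (P - V).
Proof.
move=> Ps hP hV.
have -> : (A + B *m B^T *m P)^T = A^T + P *m B *m B^T.
  by rewrite linearD /= !trmx_mul trmxK Ps mulmxA.
rewrite !(mulmxBr, mulmxDl, mulmxDr, mulmxBl, mulNmx, mulmxA).
move: hP hV (P *m B *m B^T *m V) (V *m B *m B^T *m P).
move: (A^T *m P) (P *m A) (A^T *m V) (V *m A) => a b c e.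
move: (P *m B *m B^T *m P) (V *m B *m B^T *m V) => f g hP hV h k.
apply/matrixP => i j; move/matrixP: hP => /(_ i j); move/matrixP: hV => /(_ i j).
rewrite !mxE; move: (a i j) (b i j) (c i j) (e i j) (f i j) (g i j) (h i j) (k i j) (Q i j).
by clear; move=> *; lra.
Qed.

Lemma lyap_kpow_quad_pred (T : comNzRingType) n k (F : 'M[T]_(n, n ^ 2))
    (v : 'cV[T]_(n ^ k.-1)) (V : 'M[T]_(n, n ^ k.-2)) x :
  sym_tensor v -> v = recast (vec V) -> (1 < k)%N ->
  ((recast (lyap k.-1 F^T *m v) : 'cV_(n ^ k))^T *m kpow x k) 0 0 =
  k.-1%:R * ((F *m (tensmx x x : 'cV_(n ^ 2)))^T *m V *m kpow x k.-2) 0 0.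
Proof. by case: k v V => // k v V vs vE k1; exact: lyap_kpow_quad. Qed.

Theorem theorem5 (R : realType) (n m p d : nat)
  (A : 'M[R]_n) (F : 'M[R]_(n, n ^ 2)) (B : 'M[R]_(n, m)) (C : 'M[R]_(p, n))
  (gamma gamma0 eta : R)
  (Yinf Xinf : 'M[R]_n)
  (E : 'cV[R]_n -> R)
  (v : forall k : nat, 'cV[R]_(n ^ k))
  (V : forall k : nat, 'M[R]_(n, n ^ k.-1)) :
  gamma0%:E = hinf_opt A B C -> 0 <= gamma0 -> gamma0 < gamma ->
  eta = 1 - gamma ^- 2 ->
  filter_are_solution eta A B C Yinf ->
  control_are_solution eta A B C Xinf ->
  (forall i : 'I_n, sym_tensor (row i F)^T) ->
  is_past_energy eta A F B C E ->
  (2 <= d)%N ->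
  (forall k : nat, (2 <= k <= d)%N -> sym_tensor (v k)) ->
  (forall x : 'cV[R]_n,
     taylor0 d E x = 2^-1 * \sum_(2 <= k < d.+1) ((v k)^T *m kpow x k) 0 0) ->
  (forall k : nat, (2 <= k <= d)%N -> v k = recast (vec (V k))) ->
  let V2 : 'M[R]_n := V 2%N in
  [/\ v 2%N = recast (vec V2),
      posdef V2,
      invmx V2 = Yinf
    & 0 = A^T *m V2 + V2 *m A - eta *: (C^T *m C) + V2 *m B *m B^T *m V2]
  /\
  (forall k : nat, (2 < k <= d)%N ->
     let lin_sys (w : 'cV[R]_(n ^ k)) : Prop :=
       recast (lyap k (A + B *m B^T *m V2)^T *m w) =
         - recast (lyap k.-1 F^T *m v k.-1)
         - 4^-1 *: \sum_(3 <= i < k) \sum_(3 <= j < k | (i + j == k + 2)%N)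
             (i * j)%:R *: recast (vec ((V i)^T *m B *m B^T *m V j))
         :> 'cV[R]_(n ^ k) in
     (exists w, lin_sys w) /\
     (forall w, lin_sys w -> symmetrization_of w (v k))).
Proof.
move=> _ _ _ _ Ysol _ _ [_ [[U [Uo U0 UC]] [_ [hjb stab]]]] d2 vsym taylorE vV V2.
have Es : smooth_on U E := SmoothOn UC.
have V2s : V2^T = V2 := V2_sym d2 vsym vV.
have V2r := V2_riccati d2 Uo U0 Es vsym vV taylorE hjb.
have [Pr Ph] := invmx_filter_are Ysol.
set P := invmx Yinf in Pr Ph.
have Pp : posdef P by have [Yp _ _] := Ysol; exact: posdef_invmx.
have [Ps _] := Pp.
have AD := riccati_difference Ps Pr V2r.
have PV : V2 = P.
  have Ds : (P - V2)^T = P - V2 by rewrite linearB /= Ps V2s.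
  have Dneg x0 : dotv x0 ((P - V2) *m x0) <= 0.
    rewrite leNgt; apply/negP => x0D.
    have [H [x0H HM]] := chetaev_form Ph Ds AD x0D.
    (* The matrix for which the Chetaev form was built is the linearization of the past field. *)
    have ME : B *m B^T *m (P - V2) - (A + B *m B^T *m P) = - (A + B *m B^T *m V2).
      rewrite mulmxBr; move: (B *m B^T *m P) (B *m B^T *m V2) => X Y.
      by apply/matrixP => i j; rewrite !mxE; ring.
    rewrite ME in HM.
    have := stable_no_positive_direction d2 Uo U0 Es vsym vV taylorE stab HM x0.
    by rewrite leNgt x0H.
  apply/eqP; rewrite -subr_eq0; apply/eqP.
  apply: (@lyapunov_psd_eq0 _ _ _ (V2 - P) (- (A + B *m B^T *m P)) B _ _ Ph).
  - by rewrite linearB /= Ps V2s.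
  - by move=> x; rewrite -opprB mulNmx dotvNr oppr_ge0.
  have NT (M : 'M[R]_n) : (- M)^T = - M^T by rewrite linearN.
  rewrite -(opprB P V2) NT !mulNmx !mulmxN !opprK.
  exact: AD.
split.
  split; [by apply: vV; rewrite d2|by rewrite PV|by rewrite PV invmxK|].
  by rewrite V2r.
move=> k /andP[k2 kd] lin_sys.
have k0 : (0 < k)%N by apply: leq_trans k2.
have kd2 : (2 <= k <= d)%N by rewrite (ltnW k2).
have kd3 : (2 < k <= d)%N by rewrite k2.
pose L := \sum_(i < k) slotmx k i (A + B *m B^T *m V2)^T.
have LE (w : 'cV[R]_(n ^ k)) :
    recast (lyap k (A + B *m B^T *m V2)^T *m w) = L *m w.
  by rewrite /L -lyap_sq // -[w in RHS]recast_id mul_recast // lyap_dim_sq.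
have Lu : L \in unitmx by apply: (lyap_unitmx k0); rewrite PV; exact: Ph.
have Lsurj (rhs : 'cV[R]_(n ^ k)) : exists w : 'cV[R]_(n ^ k),
    recast (lyap k (A + B *m B^T *m V2)^T *m w) = rhs.
  by exists (invmx L *m rhs); rewrite LE mulmxA mulmxV // mul1mx.
split; first exact: Lsurj.
move=> w; rewrite /lin_sys LE => wE; split; first exact: vsym.
(* Agreement with [w] on all powers means that [v k - w] lies in the subspace [K]; it is enough that
   its image under [L] does. *)
pose K (u : 'cV[R]_(n ^ k)) := forall x : 'cV[R]_n, (u^T *m kpow x k) 0 0 = 0.
suff Kvw : K (v k - w).
  move=> x; apply/matrixP => i j; rewrite (ord1 i) (ord1 j); apply/eqP.
  by rewrite -subr_eq0; have := Kvw x; rewrite linearB mulmxBl !mxE => ->.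
apply: (unitmx_invariant Lu (K := K)).
- by move=> x; rewrite trmx0 mul0mx mxE.
- move=> a u u' Ku Ku' x; rewrite linearP /= mulmxDl -scalemxAl.
  by rewrite mxE [X in X + _]mxE (Ku x) (Ku' x) mulr0 addr0.
(* The transpose of [L] differentiates the power of [x] along a line; a polynomial that vanishes
   identically has no linear coefficient. *)
- move=> u Ku x; rewrite -LE lyap_kpow_slots // summxE.
  have [q [qE _ <-]] := mul_kpow_line u x ((A + B *m B^T *m V2) *m x).
  have -> : q = 0 by apply: poly_ext => s; rewrite -qE Ku horner0.
  by rewrite coef0.
(* On the powers of [x], the image of [v k] minus the right-hand side of the system is the degree
   [k] coefficient of the Hamilton-Jacobi-Bellman equation. *)
move=> x; rewrite mulmxBr wE -LE linearB mulmxBl mxE [X in _ + X]mxE.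
rewrite (lyap_kpow _ x (vsym _ kd2) (vV _ kd2) k0).
set Z1 : 'cV[R]_(n ^ k) := recast _; set Z2 : 'cV[R]_(n ^ k) := \sum_(_ <= _ < _) _.
have -> : ((- Z1 - 4^-1 *: Z2)^T *m kpow x k) 0 0 =
    - (Z1^T *m kpow x k) 0 0 - 4^-1 * (Z2^T *m kpow x k) 0 0.
  rewrite linearB /= mulmxBl mxE; congr (_ + _).
    by rewrite linearN mulNmx mxE.
  by rewrite mxE linearZ -scalemxAl mxE.
have k1 : (2 <= k.-1 <= d)%N by lia.
rewrite /Z1 (lyap_kpow_quad_pred _ x (vsym _ k1) (vV _ k1)); last by lia.
have -> : (Z2^T *m kpow x k) 0 0 =
    \sum_(3 <= i < k) \sum_(3 <= j < k | (i + j == k + 2)%N) (i * j)%:R *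
      ((kpow x i.-1)^T *m ((V i)^T *m B *m B^T *m V j) *m kpow x j.-1) 0 0.
  rewrite /Z2 linear_sum mulmx_suml summxE; apply: eq_big_nat => i /andP[i3 _].
  rewrite linear_sum mulmx_suml summxE big_nat_cond [RHS]big_nat_cond.
  apply: eq_bigr => j /andP[/andP[j3 _] /eqP ijk].
  by rewrite linearZ -scalemxAl mxE vec_kpow_quad.
have := hjb_identity_high d2 Uo U0 Es vsym vV taylorE hjb x kd3.
by rewrite -/V2 => h; rewrite -[RHS]h; ring.
Qed.
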